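(* Let $R$ be an associative commutative ring with identity and let $\Gamma$ be a quasi-finite EI-category. Suppose that for every morphism $f\colon x\to y$ in $\Gamma$ the order of the finite group $\{g\in\mathrm{aut}(x)\mid f\circ g=f\}$ is invertible in $R$. Then $$\mathrm{Res}\colon K_0(R\Gamma)\to\mathrm{Split}K_0(R\Gamma),\quad [P]\mapsto\{[\mathrm{Res}_xP]\mid\overline{x}\in\mathrm{iso}(\Gamma)\},$$ $$I\colon\mathrm{Split}K_0(R\Gamma)\to K_0(R\Gamma),\quad\{[Q_x]\mid\overline{x}\in\mathrm{iso}(\Gamma)\}\mapsto\sum_{\overline{x}\in\mathrm{iso}(\Gamma)}[I_xQ_x]$$ are (well-defined) isomorphisms which are inverse to one another.
   Context: An EI-category is a small category in which every endomorphism is an isomorphism. $\mathrm{iso}(\Gamma)$ is the set of isomorphism classes $\overline{x}$ of objects, and a representative $x$ of each class is fixed. Write $\overline{x}\le\overline{y}$ iff $\mathrm{mor}(x,y)\neq\emptyset$. $\Gamma$ is quasi-finite if for every $\overline{x}$ the set $\{\overline{y}\mid\overline{y}\le\overline{x}\}$ is finite and for all objects $x,y$ the right $\mathrm{aut}(x)$-set $\mathrm{mor}(x,y)$ is proper (all isotropy groups finite) and cofinite (finitely many orbits). An $R\Gamma$-module is a functor $\Gamma^{op}\to R\text{-Mod}$; morphisms are natural transformations and exactness is objectwise. $R\,\mathrm{mor}(?,x)$ is the $R\Gamma$-module sending $y$ to the free $R$-module on $\mathrm{mor}(y,x)$. A finitely generated (f.g.) free $R\Gamma$-module is a finite direct sum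 of such modules; a f.g. projective one is a direct summand of a f.g. free one. $K_0(R\Gamma)$ is the abelian group generated by isomorphism classes of f.g. projective $R\Gamma$-modules with relations $[P_0]-[P_1]+[P_2]=0$ for short exact sequences $0\to P_0\to P_1\to P_2\to0$. If an $R\Gamma$-module $M$ has a finite projective resolution $P_*$ (finitely many nonzero terms, each f.g. projective), its class is $[M]:=\sum_n(-1)^n[P_n]\in K_0(R\Gamma)$; similarly over group rings. $R[x]:=R[\mathrm{aut}(x)]$, with right modules; $\mathrm{Split}K_0(R\Gamma):=\bigoplus_{\overline{x}\in\mathrm{iso}(\Gamma)}K_0(R[x])$. $\mathrm{Res}_xM:=M(x)$, as a right $R[x]$-module. For a right $R[x]$-module $N$, $I_xN$ is the $R\Gamma$-module with $I_xN(y)=N\otimes_{R[x]}R\,\mathrm{mor}(y,x)$ if $\overline{y}=\overline{x}$ and $I_xN(y)=0$ if $\overline{y}\ne\overline{x}$ (it need not be projective; $[I_xQ_x]$ is the class defined via a finite projective resolution). *)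

(* Defs.v *)
From HB Require Import structures.
From mathcomp Require Import all_boot all_order all_algebra.
From mathcomp Require Import finmap.
From mathcomp Require Import boolp classical_sets functions cardinality fsbigop.

Set Implicit Arguments.
Unset Strict Implicit.
Unset Printing Implicit Defensive.

Import GRing.Theory.
Local Open Scope classical_set_scope.
Local Open Scope quotient_scope.
Local Open Scope ring_scope.

#[local] Obligation Tactic := idtac.

Definition finsupp (R : pzRingType) (S : Type) : {pred S -> R^o} :=
  [pred f : S -> R^o | `[< finite_set [set s | f s <> 0] >]].

Lemma finsupp_closed (R : pzRingType) (S : Type) :
  @subsemimod_closed R (S -> R^o) (@finsupp R S).
Proof.
split; first split.
- by apply/asboolP; apply: (sub_finite_set _ (@finite_set0 S)) => s /=; case.
- move=> f g /asboolP hf /asboolP hg; apply/asboolP.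
  apply: (@sub_finite_set _ _ ([set s | f s <> 0] `|` [set s | g s <> 0])).
    move=> s /= h; case: (pselect (f s = 0)) => fs; last by left.
    by right=> gs; apply: h; rewrite addrfctE fs gs addr0.
  by rewrite finite_setU.
- move=> a f /asboolP hf; apply/asboolP; apply: sub_finite_set hf => s /= h fs.
  by apply: h; rewrite scalrfctE fs scaler0.
Qed.

HB.instance Definition _ (R : pzRingType) (S : Type) :=
  GRing.isSubmodClosed.Build R (S -> R^o) (@finsupp R S) (@finsupp_closed R S).

(* The free R-module on S, realized as the finitely supported functions S -> R. *)
Record freemod (R : pzRingType) (S : Type) :=
  FreeMod { freemod_val : S -> R^o; _ : freemod_val \in @finsupp R S }.

HB.instance Definition _ (R : pzRingType) (S : Type) :=
  [isSub for @freemod_val R S].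
HB.instance Definition _ (R : pzRingType) (S : Type) :=
  [Choice of freemod R S by <:].
HB.instance Definition _ (R : pzRingType) (S : Type) :=
  [SubChoice_isSubLmodule of freemod R S by <:].

Definition freemod_coef (R : pzRingType) (S : Type) (f : freemod R S) (s : S) : R :=
  freemod_val f s.
Coercion freemod_coef : freemod >-> Funclass.

Section FreeModule.
Variables (R : pzRingType) (S : Type).

Lemma freemod_finite (f : freemod R S) : finite_set [set s | f s <> 0].
Proof. by case: f => f /= /asboolP. Qed.

Definition single_fun (s : S) : S -> R^o := fun t => if `[< t = s >] then 1 else 0.

Lemma single_finsupp (s : S) : single_fun s \in @finsupp R S.
Proof.
apply/asboolP; apply: (sub_finite_set _ (finite_set1 s)) => t /=.
by rewrite /single_fun; case: asboolP.
Qed.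

Definition single (s : S) : freemod R S := FreeMod (single_finsupp s).

Lemma singleE s t : single s t = if `[< t = s >] then 1 else 0.
Proof. by []. Qed.

Definition fsupport (f : freemod R S) : {fset {classic S}} :=
  fset_set [set s : {classic S} | f s <> 0].

Lemma in_fsupport (f : freemod R S) s : (s \in fsupport f) = `[< f s <> 0 >].
Proof.
rewrite in_fset_set; last exact: (@freemod_finite f).
by apply/idP/asboolP; rewrite inE.
Qed.

Lemma freemodZD a (f g : freemod R S) s : (a *: f + g) s = a * f s + g s.
Proof. by []. Qed.

Lemma fsupportP (f : freemod R S) (A : {fset {classic S}}) :
  (fsupport f `<=` A)%fset -> forall s, s \notin A -> f s = 0.
Proof.
move=> /fsubsetP fA s sA; apply: contrapT => fs; move/negP: sA; apply.
by apply: fA; rewrite in_fsupport; apply/asboolP.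
Qed.
End FreeModule.

Section FreeModuleLift.
Variables (R : pzRingType) (S : Type) (V : lmodType R) (phi : S -> V).

Definition freemod_ext (f : freemod R S) : V :=
  \sum_(s <- fsupport f) f s *: phi s.

Lemma freemod_extE (f : freemod R S) (A : {fset {classic S}}) :
  (fsupport f `<=` A)%fset -> freemod_ext f = \sum_(s <- A) f s *: phi s.
Proof.
move=> fA; rewrite /freemod_ext (big_fset_incl _ fA) //= => s sA sf.
by rewrite (fsupportP (fsubset_refl _) sf) scale0r.
Qed.

Lemma freemod_ext_linear : linear freemod_ext.
Proof.
move=> a f g.
set A := (fsupport f `|` fsupport g `|` fsupport (a *: f + g)%R)%fset.
rewrite (@freemod_extE f A) ?(@freemod_extE g A) ?(@freemod_extE (a *: f + g) A).
- rewrite scaler_sumr -big_split /=; apply: eq_bigr => s _.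
  by rewrite -[LHS]/((a * f s + g s) *: phi s) scalerDl scalerA.
- exact: fsubsetUr.
- by rewrite /A fsubsetU // fsubsetUr.
- by rewrite /A fsubsetU // fsubsetUl.
Qed.

HB.instance Definition _ :=
  GRing.isLinear.Build R (freemod R S) V *:%R freemod_ext freemod_ext_linear.

Lemma freemod_ext_single s : freemod_ext (single R s) = phi s.
Proof.
rewrite (@freemod_extE _ [fset (s : {classic S})]%fset).
  by rewrite big_seq_fset1 singleE; case: asboolP => // _; rewrite scale1r.
apply/fsubsetP => t; rewrite in_fsupport inE => /asboolP.
by rewrite singleE; case: asboolP => // ->; rewrite eqxx.
Qed.
End FreeModuleLift.

Lemma freemod_single (R : pzRingType) S (f : freemod R S) :
  f = freemod_ext (@single R S) f.
Proof.
apply: val_inj; apply/funext => t /=.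
have ev_lin : linear (fun g : freemod R S => (g t : R^o)) by move=> a g h.
pose ev : {linear freemod R S -> R^o} :=
  HB.pack (fun g : freemod R S => (g t : R^o))
    (GRing.isLinear.Build _ _ _ _ _ ev_lin).
rewrite -[RHS]/(ev _) /freemod_ext raddf_sum /=.
have H s : s \in fsupport f -> (f s *: single R s) t
    = if (s : {classic S}) == t then f t else 0.
  move=> _; rewrite -[LHS]/(f s * single R s t) singleE.
  case: asboolP => [->|]; first by rewrite eqxx mulr1.
  by case: eqP => [->//|_ _]; rewrite mulr0.
rewrite (eq_big_seq _ H); case: (boolP ((t : {classic S}) \in fsupport f)) => tf.
  rewrite (big_fsetD1 (t : {classic S})) //= eqxx big1_seq ?addr0 // => s /=.
  by rewrite in_fsetD1 => /andP[/negPf ->].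
rewrite -[LHS]/(f t) (fsupportP (fsubset_refl _) tf) big1_seq // => s /= sf.
by case: eqP => // <-; rewrite (fsupportP (fsubset_refl _) tf).
Qed.

Lemma freemod_ind (R : pzRingType) S (V : lmodType R)
    (F G : {linear freemod R S -> V}) :
  (forall s, F (single R s) = G (single R s)) -> F =1 G.
Proof.
move=> FG f; rewrite (freemod_single f) /freemod_ext !raddf_sum.
by apply: eq_bigr => s _; rewrite -[LHS]/(F (f s *: single R s)) -[RHS]/(G (f s *: single R s)) !linearZZ FG.
Qed.

Inductive in_span (R : pzRingType) (V : lmodType R) (A : set V) : V -> Prop :=
| in_span0 : in_span A 0
| in_span_incl v : A v -> in_span A v
| in_span_lin a u v : in_span A u -> in_span A v -> in_span A (a *: u + v).

Section SpanQuotient.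
Variables (R : pzRingType) (V : lmodType R) (A : set V).

Definition span_pred : {pred V} := [pred v | `[< in_span A v >]].

Lemma span_closed : subsemimod_closed span_pred.
Proof.
split; first split.
- by apply/asboolP; exact: in_span0.
- move=> u v /asboolP hu /asboolP hv; apply/asboolP.
  by rewrite -[u]scale1r; exact: in_span_lin.
- move=> a v /asboolP hv; apply/asboolP.
  by rewrite -[_ *: _]addr0; apply: in_span_lin => //; exact: in_span0.
Qed.

HB.instance Definition _ := GRing.isSubmodClosed.Build R V span_pred span_closed.

Definition quot_span : Type := Quotient.quot span_pred.
HB.instance Definition _ := GRing.Zmodule.on quot_span.

Definition quot_pi (v : V) : quot_span := \pi_(Quotient.quot span_pred) v.
Definition quot_repr (q : quot_span) : V := repr (q : Quotient.quot span_pred).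

Lemma quot_reprK q : quot_pi (quot_repr q) = q.
Proof. exact: reprK. Qed.

Lemma quot_piP u v : quot_pi u = quot_pi v <-> in_span A (u - v).
Proof.
split=> [/eqP|h].
  by rewrite -Quotient.idealrBE => /asboolP.
by apply/eqP; rewrite -Quotient.idealrBE; apply/asboolP.
Qed.

Lemma quot_piD u v : quot_pi (u + v) = quot_pi u + quot_pi v.
Proof. exact: Quotient.pi_add. Qed.

Definition quot_scale a (q : quot_span) : quot_span := quot_pi (a *: quot_repr q).

Lemma quot_piZ a v : quot_pi (a *: v) = quot_scale a (quot_pi v).
Proof.
apply/quot_piP; rewrite -scalerBr -[_ *: _]addr0; apply: in_span_lin.
  by apply/quot_piP; rewrite quot_reprK.
exact: in_span0.
Qed.

Lemma quot_scaleA a b q : quot_scale a (quot_scale b q) = quot_scale (a * b) q.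
Proof. by rewrite -[q]quot_reprK -!quot_piZ scalerA. Qed.
Lemma quot_scale1 : left_id 1 quot_scale.
Proof. by move=> q; rewrite -[q]quot_reprK -!quot_piZ scale1r. Qed.
Lemma quot_scaleDr : right_distributive quot_scale +%R.
Proof.
move=> a p q; rewrite -[p]quot_reprK -[q]quot_reprK.
by rewrite -quot_piD -!quot_piZ -quot_piD scalerDr.
Qed.
Lemma quot_scaleDl q : {morph quot_scale^~ q : a b / a + b}.
Proof.
by move=> a b; rewrite -[q]quot_reprK -!quot_piZ -quot_piD scalerDl.
Qed.

HB.instance Definition _ := GRing.Zmodule_isLmodule.Build R quot_span
  quot_scaleA quot_scale1 quot_scaleDr quot_scaleDl.

Lemma quot_pi_linear : linear quot_pi.
Proof. by move=> a u v; rewrite quot_piD quot_piZ. Qed.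
HB.instance Definition _ :=
  GRing.isLinear.Build R V quot_span *:%R quot_pi quot_pi_linear.

Definition quot_lift (W : lmodType R) (F : {linear V -> W})
    (FA : forall v, A v -> F v = 0) (q : quot_span) : W := F (quot_repr q).

Section Lift.
Variables (W : lmodType R) (F : {linear V -> W}) (FA : forall v, A v -> F v = 0).

Lemma quot_lift_pi v : quot_lift FA (quot_pi v) = F v.
Proof.
rewrite /quot_lift.
have h0 w : in_span A w -> F w = 0.
  elim=> [|u /FA //|a u v' _ Fu _ Fv]; first exact: linear0.
  by rewrite linearP Fu Fv scaler0 addr0.
have /quot_piP/h0 h : quot_pi (quot_repr (quot_pi v)) = quot_pi v.
  by rewrite quot_reprK.
by apply/eqP; rewrite -subr_eq0 -linearB; apply/eqP.
Qed.

Lemma quot_lift_linear : linear (quot_lift FA).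
Proof.
move=> a p q; rewrite -[p]quot_reprK -[q]quot_reprK -linearP.
by rewrite !quot_lift_pi linearP.
Qed.
HB.instance Definition _ :=
  GRing.isLinear.Build R quot_span W *:%R (quot_lift FA) quot_lift_linear.
End Lift.
End SpanQuotient.

Definition group_ring (R : comPzRingType) (G : groupType) : Type := freemod R G.

HB.instance Definition _ (R : comPzRingType) (G : groupType) :=
  GRing.Lmodule.on (group_ring R G).

Section GroupRing.
Variables (R : comPzRingType) (G : groupType).
Local Notation RG := (group_ring R G).

Lemma freemod_ext_fun_linear S (V : lmodType R) a (phi psi : S -> V)
    (f : freemod R S) :
  freemod_ext (fun s => a *: phi s + psi s) f =
  a *: freemod_ext phi f + freemod_ext psi f.
Proof.
rewrite /freemod_ext scaler_sumr -big_split /=; apply: eq_bigr => s _.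
by rewrite scalerDr !scalerA mulrC.
Qed.

Lemma eq_freemod_ext S (V : lmodType R) (phi psi : S -> V) :
  phi =1 psi -> freemod_ext phi =1 freemod_ext psi.
Proof. by move=> /funext ->. Qed.

Definition gr_mul (f g : RG) : RG :=
  freemod_ext (fun x => freemod_ext (fun y => single R (x * y)%g) g) f.
Definition gr_mulr (g f : RG) : RG := gr_mul f g.

Lemma gr_mul_linear f : linear (gr_mul f).
Proof.
move=> a g h; rewrite /gr_mul -freemod_ext_fun_linear.
by apply: eq_freemod_ext => x; rewrite linearP.
Qed.
HB.instance Definition _ f :=
  GRing.isLinear.Build R RG RG *:%R (gr_mul f) (gr_mul_linear f).

Lemma gr_mulr_linear g : linear (gr_mulr g).
Proof. by move=> a f h; rewrite /gr_mulr /gr_mul linearP. Qed.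
HB.instance Definition _ g :=
  GRing.isLinear.Build R RG RG *:%R (gr_mulr g) (gr_mulr_linear g).

Lemma gr_mul_single x y : gr_mul (single R x) (single R y) = single R (x * y)%g.
Proof. by rewrite /gr_mul !freemod_ext_single. Qed.

Definition gr_one : RG := single R 1%g.

Lemma gr_mulA : associative gr_mul.
Proof.
move=> f g h.
apply: (@freemod_ind _ _ _ (gr_mul f \o gr_mul g) (gr_mul (gr_mul f g))) => z /=.
apply: (@freemod_ind _ _ _ (gr_mul f \o gr_mulr (single R z))
  (gr_mulr (single R z) \o gr_mul f)) => y /=.
apply: (@freemod_ind _ _ _ (gr_mulr (gr_mul (single R y) (single R z)))
  (gr_mulr (single R z) \o gr_mulr (single R y))) => x /=.
by rewrite /gr_mulr !gr_mul_single mulgA.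
Qed.

Lemma gr_mul1 : left_id gr_one gr_mul.
Proof.
move=> f; apply: (@freemod_ind _ _ _ (gr_mul gr_one) idfun) => x /=.
by rewrite gr_mul_single mul1g.
Qed.

Lemma gr_mulr1 : right_id gr_one gr_mul.
Proof.
move=> f; apply: (@freemod_ind _ _ _ (gr_mulr gr_one) idfun) => x /=.
by rewrite /gr_mulr gr_mul_single mulg1.
Qed.

Lemma gr_mulDl : left_distributive gr_mul +%R.
Proof. by move=> f g h; rewrite -![gr_mul _ h]/(gr_mulr h _) linearD. Qed.

Lemma gr_mulDr : right_distributive gr_mul +%R.
Proof. by move=> f g h; rewrite linearD. Qed.

HB.instance Definition _ := GRing.Zmodule_isPzRing.Build RG
  gr_mulA gr_mul1 gr_mulr1 gr_mulDl gr_mulDr.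
End GroupRing.

Record category := Category {
  ob :> Type;
  hom : ob -> ob -> Type;
  idm : forall x, hom x x;
  comp : forall x y z, hom y z -> hom x y -> hom x z;
  comp_idl : forall x y (f : hom x y), comp (idm y) f = f;
  comp_idr : forall x y (f : hom x y), comp f (idm x) = f;
  compA : forall x y z w (h : hom z w) (g : hom y z) (f : hom x y),
    comp h (comp g f) = comp (comp h g) f }.

Arguments hom {c} x y : rename.
Arguments idm {c} x : rename.
Notation "g <o> f" := (comp g f) (at level 40, left associativity).

Definition is_iso (C : category) (x y : C) (f : hom x y) : Prop :=
  exists g : hom y x, g <o> f = idm x /\ f <o> g = idm y.

Definition isomorphic (C : category) (x y : C) : Prop :=
  exists f : hom x y, is_iso f.

Record EI_category := EICategory {
  EI_cat :> category;
  EI_axiom : forall (x : EI_cat) (f : hom x x), is_iso f }.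

Record aut (C : category) (x : C) := Aut {
  aut_hom :> hom x x;
  aut_inv : hom x x;
  aut_invl : aut_inv <o> aut_hom = idm x;
  aut_invr : aut_hom <o> aut_inv = idm x }.

Section AutGroup.
Variables (C : category) (x : C).

Lemma aut_inj : injective (@aut_hom C x).
Proof.
case=> [f f' fl fr] [g g' gl gr] /= fg; case: _ / fg gl gr => gl gr.
have E : f' = g' by rewrite -[f']comp_idr -gr compA fl comp_idl.
by case: _ / E gl gr => gl gr; congr Aut; exact: Prop_irrelevance.
Qed.

HB.instance Definition _ := gen_eqMixin (aut x).
HB.instance Definition _ := gen_choiceMixin (aut x).

Definition aut_one : aut x := Aut (comp_idl (idm x)) (comp_idl (idm x)).

Lemma aut_mul_subproof (g h : aut x) :
  (aut_inv h <o> aut_inv g) <o> (g <o> h) = idm x.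
Proof. by rewrite compA -(compA (aut_inv h)) aut_invl comp_idr aut_invl. Qed.

Lemma aut_mul_subproof' (g h : aut x) :
  (g <o> h) <o> (aut_inv h <o> aut_inv g) = idm x.
Proof. by rewrite compA -(compA (aut_hom g)) aut_invr comp_idr aut_invr. Qed.

Definition aut_mul (g h : aut x) : aut x :=
  Aut (aut_mul_subproof g h) (aut_mul_subproof' g h).
Definition aut_opp (g : aut x) : aut x := Aut (aut_invr g) (aut_invl g).

Lemma aut_mulA : associative aut_mul.
Proof. by move=> f g h; apply: aut_inj; exact: compA. Qed.
Lemma aut_mul1 : left_id aut_one aut_mul.
Proof. by move=> f; apply: aut_inj; exact: comp_idl. Qed.
Lemma aut_mulr1 : right_id aut_one aut_mul.
Proof. by move=> f; apply: aut_inj; exact: comp_idr. Qed.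
Lemma aut_mulV : left_inverse aut_one aut_opp aut_mul.
Proof. by move=> f; apply: aut_inj; exact: aut_invl. Qed.
Lemma aut_mulrV : right_inverse aut_one aut_opp aut_mul.
Proof. by move=> f; apply: aut_inj; exact: aut_invr. Qed.

HB.instance Definition _ := isGroup.Build (aut x)
  aut_mulA aut_mul1 aut_mulr1 aut_mulV aut_mulrV.
End AutGroup.

Record RG_module (R : pzRingType) (C : category) := RGModule {
  mod_at :> C -> lmodType R;
  mod_map : forall y z : C, hom y z -> {linear mod_at z -> mod_at y};
  mod_map_id : forall (y : C) (m : mod_at y), mod_map (idm y) m = m;
  mod_map_comp : forall (y z w : C) (g : hom z w) (f : hom y z) (m : mod_at w),
    mod_map (g <o> f) m = mod_map f (mod_map g m) }.

Record RG_hom (R : pzRingType) (C : category) (M N : RG_module R C) := RGHom {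
  hom_at :> forall y : C, {linear M y -> N y};
  hom_natural : forall (y z : C) (f : hom y z) (m : M z),
    hom_at y (mod_map M f m) = mod_map N f (hom_at z m) }.

Section RGConstructions.
Variables (R : pzRingType) (C : category).

Program Definition RG_zero : RG_module R C :=
  @RGModule R C (fun _ => 'rV[R]_0) (fun _ _ _ => idfun) _ _.
Next Obligation. by []. Qed.
Next Obligation. by []. Qed.

Definition pair_map (V V' W W' : lmodType R) (F : {linear V -> V'})
  (G : {linear W -> W'}) (p : V * W) : V' * W' := (F p.1, G p.2).

Lemma pair_map_linear V V' W W' F G : linear (@pair_map V V' W W' F G).
Proof. by move=> a p q; rewrite /pair_map /= !linearP. Qed.
HB.instance Definition _ (V V' W W' : lmodType R) (F : {linear V -> V'})
    (G : {linear W -> W'}) :=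
  GRing.isLinear.Build R ((V * W)%type : lmodType R)
    ((V' * W')%type : lmodType R) *:%R
    (@pair_map V V' W W' F G) (@pair_map_linear V V' W W' F G).

Program Definition RG_sum (M N : RG_module R C) : RG_module R C :=
  @RGModule R C (fun y => (M y * N y)%type)
    (fun y z f => pair_map (mod_map M f) (mod_map N f)) _ _.
Next Obligation.
by move=> M N y [m n] /=; rewrite /pair_map /= !mod_map_id.
Qed.
Next Obligation.
by move=> M N y z w g f [m n] /=; rewrite /pair_map /= !mod_map_comp.
Qed.

(* R mor(?, x); hom y z acts by precomposition. *)
Program Definition RG_mor (x : C) : RG_module R C :=
  @RGModule R C (fun y => freemod R (hom y x))
    (fun y z f => @freemod_ext R (hom z x) _ (fun h => single R (h <o> f))) _ _.
Next Obligation.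
move=> x y; apply: (@freemod_ind _ _ _
  (freemod_ext (fun h => single R (h <o> idm y))) idfun) => h.
by rewrite /= freemod_ext_single comp_idr.
Qed.
Next Obligation.
move=> x y z w g f; apply: (@freemod_ind _ _ _
  (freemod_ext (fun h => single R (h <o> (g <o> f))))
  (freemod_ext (fun h => single R (h <o> f)) \o
   freemod_ext (fun h => single R (h <o> g)))) => h.
by rewrite /= !freemod_ext_single compA.
Qed.

Definition RG_free (s : seq C) : RG_module R C :=
  foldr (fun x => RG_sum (RG_mor x)) RG_zero s.

End RGConstructions.

Section Restriction.
Variables (R : comPzRingType) (C : category) (M : RG_module R C) (x : C).
Local Notation Rx := (group_ring R (aut x)).

Definition res_carrier : Type := M x.
HB.instance Definition _ := GRing.Lmodule.on res_carrier.

Definition res_act (a : Rx) (m : res_carrier) : res_carrier :=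
  freemod_ext (fun g : aut x => mod_map M g m) a.
Definition res_actr (m : res_carrier) (a : Rx) : res_carrier := res_act a m.

Lemma res_act_linear a : linear (res_act a).
Proof.
move=> r m n; rewrite /res_act -freemod_ext_fun_linear.
by apply: eq_freemod_ext => g; rewrite linearP.
Qed.
HB.instance Definition _ a := GRing.isLinear.Build R res_carrier res_carrier *:%R
  (res_act a) (res_act_linear a).

Lemma res_actr_linear m : linear (res_actr m).
Proof. by move=> r a b; rewrite /res_actr /res_act linearP. Qed.
HB.instance Definition _ m := GRing.isLinear.Build R Rx res_carrier *:%R
  (res_actr m) (res_actr_linear m).

Lemma res_act_single (g : aut x) m : res_act (single R g) m = mod_map M g m.
Proof. exact: freemod_ext_single. Qed.

Lemma res_actA (a b : Rx^c) m : res_act a (res_act b m) = res_act (a * b) m.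
Proof.
apply: (@freemod_ind _ _ _ (res_act a \o res_actr m)
   (res_actr m \o gr_mulr a)) b => h /=.
apply: (@freemod_ind _ _ _ (res_actr (res_act (single R h) m))
   (res_actr m \o gr_mul (single R h))) a => g /=.
by rewrite /res_actr gr_mul_single !res_act_single mod_map_comp.
Qed.

Lemma res_act1 : left_id (1 : Rx^c) res_act.
Proof. by move=> m; rewrite res_act_single mod_map_id. Qed.
Lemma res_actDr : right_distributive (res_act : Rx^c -> _ -> _) +%R.
Proof. by move=> a m n; rewrite linearD. Qed.
Lemma res_actDl m : {morph (fun a : Rx^c => res_act a m) : a b / a + b}.
Proof. by move=> a b; rewrite -![res_act _ m]/(res_actr m _) linearD. Qed.
End Restriction.

(* M(x) as a right R[x]-module: m . g = M(g)(m). *)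
Definition res_at (R : comPzRingType) (C : category) (M : RG_module R C) (x : C)
    : Type := M x.
HB.instance Definition _ R C M x := GRing.Zmodule.on (@res_at R C M x).
HB.instance Definition _ R C M x :=
  GRing.Zmodule_isLmodule.Build (group_ring R (aut x))^c (@res_at R C M x)
    (@res_actA R C M x) (@res_act1 R C M x) (@res_actDr R C M x)
    (@res_actDl R C M x).

Definition Res (R : comPzRingType) (C : category) (x : C) (M : RG_module R C)
  : lmodType (group_ring R (aut x))^c := res_at M x.

(* N (x)_A L for a right A-module N and an R-module L with a left action of the
   R-algebra A: the R-module generated by the symbols n (x) l subject to
   biadditivity, A-balancedness and r (n (x) l) = n (x) r l. *)
Section Tensor.
Variables (R A : pzRingType) (N : lmodType A^c) (L : lmodType R).
Variable act : A -> L -> L.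

Inductive tensor_rel : set (freemod R (N * L)) :=
| tensor_addl n n' l :
    tensor_rel (single R (n + n', l) - (single R (n, l) + single R (n', l)))
| tensor_addr n l l' :
    tensor_rel (single R (n, l + l') - (single R (n, l) + single R (n, l')))
| tensor_balanced n (a : A) l :
    tensor_rel (single R ((a : A^c) *: n, l) - single R (n, act a l))
| tensor_scale (r : R) n l :
    tensor_rel (single R (n, r *: l) - r *: single R (n, l)).

Definition tensor : lmodType R := quot_span tensor_rel.
Definition tens (n : N) (l : L) : tensor :=
  @quot_pi _ _ tensor_rel (single R (n, l)).

Lemma tens_eq u v : tensor_rel (u - v) -> quot_pi tensor_rel u = quot_pi tensor_rel v.
Proof. by move=> h; apply/quot_piP; exact: in_span_incl. Qed.

Lemma tensDl n n' l : tens (n + n') l = tens n l + tens n' l.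
Proof. by rewrite -[RHS]quot_piD; apply: tens_eq; exact: tensor_addl. Qed.
Lemma tensDr n l l' : tens n (l + l') = tens n l + tens n l'.
Proof. by rewrite -[RHS]quot_piD; apply: tens_eq; exact: tensor_addr. Qed.
Lemma tens_act n (a : A) l : tens ((a : A^c) *: n) l = tens n (act a l).
Proof. by apply: tens_eq; exact: tensor_balanced. Qed.
Lemma tensZ r n l : tens n (r *: l) = r *: tens n l.
Proof. by rewrite -[RHS]quot_piZ; apply: tens_eq; exact: tensor_scale. Qed.

Lemma tensor_ind (W : lmodType R) (F G : {linear tensor -> W}) :
  (forall n l, F (tens n l) = G (tens n l)) -> F =1 G.
Proof.
move=> FG t; rewrite -[t]quot_reprK.
apply: (@freemod_ind _ _ _ (F \o @quot_pi _ _ tensor_rel)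
  (G \o @quot_pi _ _ tensor_rel)) => -[n l]; exact: FG.
Qed.
End Tensor.

Section TensorMap.
Variables (R A : pzRingType) (N : lmodType A^c) (L L' : lmodType R).
Variables (act : A -> L -> L) (act' : A -> L' -> L') (F : {linear L -> L'}).
Hypothesis FA : forall a l, F (act a l) = act' a (F l).

Definition tensor_map_free : {linear freemod R (N * L) -> tensor N act'} :=
  freemod_ext (fun p : N * L => tens act' p.1 (F p.2)).

Lemma tensor_map_rel v : tensor_rel act v -> tensor_map_free v = 0.
Proof.
case=> [n n' l|n l l'|n a l|r n l]; rewrite /tensor_map_free /=;
  rewrite linearB ?linearD ?linearZZ /= !freemod_ext_single /=.
- by rewrite -opprD tensDl subrr.
- by rewrite -opprD linearD tensDr subrr.
- by rewrite FA tens_act subrr.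
- by rewrite (linearZZ F) tensZ scalerN subrr.
Qed.

Definition tensor_map : {linear tensor N act -> tensor N act'} :=
  quot_lift tensor_map_rel.

Lemma tensor_mapE n l : tensor_map (tens act n l) = tens act' n (F l).
Proof. by rewrite [LHS](quot_lift_pi tensor_map_rel) /= freemod_ext_single. Qed.
End TensorMap.

Section Inclusion.
Variables (R : comPzRingType) (C : category) (x : C).
Local Notation Rx := (group_ring R (aut x)).

(* aut(x) acts on the left of R mor(y, x) by postcomposition. *)
Definition mor_act (y : C) (a : Rx) (l : RG_mor R x y) : RG_mor R x y :=
  freemod_ext (fun g : aut x => freemod_ext (fun h => single R (g <o> h)) l) a.

Lemma mor_act_map (y z : C) (f : hom y z) a l :
  mod_map (RG_mor R x) f (mor_act a l) = mor_act a (mod_map (RG_mor R x) f l).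
Proof.
rewrite /mor_act /freemod_ext linear_sum; apply: eq_bigr => g _.
rewrite linearZZ; congr (_ *: _).
apply: (@freemod_ind _ _ _
  (freemod_ext (fun h => single R (h <o> f)) \o
   freemod_ext (fun h => single R (g <o> h)))
  (freemod_ext (fun h => single R (g <o> h)) \o
   freemod_ext (fun h => single R (h <o> f)))) => h /=.
by rewrite !freemod_ext_single compA.
Qed.

Variable N : lmodType Rx^c.

Definition mor_tensor (y : C) : lmodType R := tensor N (@mor_act y).

Definition mor_tensor_map (y z : C) (f : hom y z) :
    {linear mor_tensor z -> mor_tensor y} :=
  tensor_map N (mor_act_map f).

Lemma mor_tensor_map_id y t : mor_tensor_map (idm y) t = t.
Proof.
apply: (@tensor_ind _ _ _ _ _ _ (mor_tensor_map (idm y)) idfun) => n l.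
by rewrite [LHS]tensor_mapE mod_map_id.
Qed.

Lemma mor_tensor_map_comp y z w (g : hom z w) (f : hom y z) t :
  mor_tensor_map (g <o> f) t = mor_tensor_map f (mor_tensor_map g t).
Proof.
apply: (@tensor_ind _ _ _ _ _ _ (mor_tensor_map (g <o> f))
  (mor_tensor_map f \o mor_tensor_map g)) => n l.
transitivity (mor_tensor_map f (tens (@mor_act z) n (mod_map (RG_mor R x) g l))).
  by rewrite [LHS]tensor_mapE [RHS]tensor_mapE mod_map_comp.
by congr (mor_tensor_map f _); rewrite [RHS]tensor_mapE.
Qed.
End Inclusion.

(* V if P holds, the zero module otherwise. *)
Definition guard (R : pzRingType) (P : Prop) (p : {P} + {~ P}) (V : lmodType R)
    : lmodType R :=
  if p then V else 'rV[R]_0.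

Definition guard_map (R : pzRingType) (P Q : Prop) (p : {P} + {~ P})
    (q : {Q} + {~ Q}) (V W : lmodType R) (F : {linear V -> W})
    : {linear guard p V -> guard q W} :=
  match p, q return {linear guard p V -> guard q W} with
  | left _, left _ => F
  | _, _ => \0
  end.

Lemma guard_map_id (R : pzRingType) (P : Prop) (p : {P} + {~ P})
    (V : lmodType R) (F : {linear V -> V}) :
  F =1 id -> guard_map p p F =1 id.
Proof. by move=> F1; case: p => p m //=; rewrite [LHS]thinmx0 [RHS]thinmx0. Qed.

Lemma guard_map_comp (R : pzRingType) (P Q S : Prop) (p : {P} + {~ P})
    (q : {Q} + {~ Q}) (s : {S} + {~ S}) (V W U : lmodType R)
    (F : {linear V -> W}) (G : {linear W -> U}) (H : {linear V -> U}) :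
  (P -> S -> Q) -> H =1 G \o F ->
  guard_map p s H =1 guard_map q s G \o guard_map p q F.
Proof.
move=> PSQ HE; case: p => p; case: s => s; case: q => q m //=.
- by case: q; exact: PSQ.
- by rewrite linear0.
Qed.

Section InclusionFunctor.
Variables (R : comPzRingType) (C : EI_category) (x : C).
Variable N : lmodType (group_ring R (aut x))^c.

Lemma EI_between (y z w : C) (f : hom y z) (g : hom z w) :
  isomorphic y x -> isomorphic w x -> isomorphic z x.
Proof.
move=> [i [i' [ii' i'i]]] [j [j' [jj' j'j]]].
have [u [_ ru]] := EI_axiom (f <o> (i' <o> j <o> g)).
have [v [lv _]] := EI_axiom (i' <o> j <o> g <o> f).
set k := i' <o> j <o> g in ru lv.
have fk : f <o> (k <o> u) = idm z by rewrite compA.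
have vkf : (v <o> k) <o> f = idm y by rewrite -compA.
have E : v <o> k = k <o> u.
  by rewrite -[LHS]comp_idr -fk compA vkf comp_idl.
exists (i <o> (v <o> k)), (f <o> i'); split.
  by rewrite compA -(compA f) ii' comp_idr E fk.
by rewrite -compA (compA (v <o> k)) vkf comp_idl.
Qed.

(* I_x N: the pselect tests decide whether y (resp. z) is isomorphic to x. *)
Program Definition Inc : RG_module R C :=
  @RGModule R C (fun y => guard (pselect (isomorphic y x)) (mor_tensor N y))
    (fun y z f => guard_map (pselect (isomorphic z x)) (pselect (isomorphic y x))
                    (mor_tensor_map N f)) _ _.
Next Obligation.
by move=> y m; apply: guard_map_id => t; exact: mor_tensor_map_id.
Qed.
Next Obligation.
move=> y z w g f m; apply: (@guard_map_comp) => [wx yx|t].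
  exact: (EI_between f g yx wx).
exact: mor_tensor_map_comp.
Qed.
End InclusionFunctor.

(* K_0 is a quotient of a type of modules, hence lives in a universe above that
   of the carriers of MathComp modules and cannot be a zmodType. *)
Record abgroup := AbGroup {
  ab_car :> Type;
  ab_zero : ab_car;
  ab_add : ab_car -> ab_car -> ab_car;
  ab_opp : ab_car -> ab_car;
  ab_addA : forall a b c, ab_add a (ab_add b c) = ab_add (ab_add a b) c;
  ab_addC : forall a b, ab_add a b = ab_add b a;
  ab_add0 : forall a, ab_add ab_zero a = a;
  ab_addN : forall a, ab_add (ab_opp a) a = ab_zero }.

Arguments ab_zero {_}.

Definition is_hom (A B : abgroup) (f : A -> B) : Prop :=
  forall a b, f (ab_add a b) = ab_add (f a) (f b).

Fixpoint ab_sum (A : abgroup) (n : nat) (F : nat -> A) : A :=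
  if n is k.+1 then ab_add (ab_sum k F) (F k) else ab_zero.

Fixpoint ab_lsum (A : abgroup) (J : Type) (s : seq J) (F : J -> A) : A :=
  if s is j :: s' then ab_add (F j) (ab_lsum s' F) else ab_zero.

(* F has finite support and a is the sum of its values. *)
Definition is_sum (A : abgroup) (J : Type) (F : J -> A) (a : A) : Prop :=
  exists s : seq {classic J}, [/\ uniq s,
    forall j : {classic J}, F j <> ab_zero -> j \in s & a = ab_lsum s F].

Section DirectSum.
Variables (J : Type) (A : J -> abgroup).

Record dsum := DSum {
  dsum_val :> forall j, A j;
  dsum_finite : finite_set [set j | dsum_val j <> ab_zero] }.

Lemma dsum_eq (a b : dsum) : (forall j, a j = b j) -> a = b.
Proof.
case: a b => [a ha] [b hb] /= ab.
have E : a = b by apply: functional_extensionality_dep.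
by case: _ / E hb => hb; congr DSum; exact: Prop_irrelevance.
Qed.

Lemma dsum_zero_finite : finite_set [set j : J | @ab_zero (A j) <> ab_zero].
Proof. by apply: (sub_finite_set _ (@finite_set0 J)) => j /=; case. Qed.

Lemma dsum_add_finite (a b : dsum) :
  finite_set [set j | ab_add (a j) (b j) <> ab_zero].
Proof.
apply: (@sub_finite_set _ _
  ([set j | a j <> ab_zero] `|` [set j | b j <> ab_zero])) => [j /= h|].
  case: (pselect (a j = ab_zero)) => aj; last by left.
  by right=> bj; apply: h; rewrite aj bj ab_add0.
by rewrite finite_setU; split; exact: dsum_finite.
Qed.

Lemma dsum_opp_finite (a : dsum) : finite_set [set j | ab_opp (a j) <> ab_zero].
Proof.
apply: sub_finite_set (dsum_finite a) => j /= h aj; apply: h.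
by rewrite aj -[LHS]ab_add0 ab_addC ab_addN.
Qed.

Program Definition direct_sum : abgroup :=
  @AbGroup dsum (DSum dsum_zero_finite) (fun a b => DSum (dsum_add_finite a b))
    (fun a => DSum (dsum_opp_finite a)) _ _ _ _.
Next Obligation. by move=> a b c; apply: dsum_eq => j; exact: ab_addA. Qed.
Next Obligation. by move=> a b; apply: dsum_eq => j; exact: ab_addC. Qed.
Next Obligation. by move=> a; apply: dsum_eq => j; exact: ab_add0. Qed.
Next Obligation. by move=> a; apply: dsum_eq => j; exact: ab_addN. Qed.
End DirectSum.

(* The abelian group generated by T subject to the relations rel. *)
Inductive gterm (T : Type) : Type :=
| gzero
| ggen of T
| gadd of gterm T & gterm T
| gopp of gterm T.

Arguments gzero {T}.

Section Presentation.
Variables (T : Type) (rel : gterm T -> gterm T -> Prop).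

Inductive pres_eq : gterm T -> gterm T -> Prop :=
| pres_rel s t : rel s t -> pres_eq s t
| pres_refl t : pres_eq t t
| pres_sym s t : pres_eq s t -> pres_eq t s
| pres_trans s t u : pres_eq s t -> pres_eq t u -> pres_eq s u
| pres_add s s' t t' :
    pres_eq s s' -> pres_eq t t' -> pres_eq (gadd s t) (gadd s' t')
| pres_opp s s' : pres_eq s s' -> pres_eq (gopp s) (gopp s')
| pres_addA s t u : pres_eq (gadd s (gadd t u)) (gadd (gadd s t) u)
| pres_addC s t : pres_eq (gadd s t) (gadd t s)
| pres_add0 t : pres_eq (gadd gzero t) t
| pres_addN t : pres_eq (gadd (gopp t) t) gzero.

Definition pres : Type := {S : gterm T -> Prop | exists t, S = pres_eq t}.
Definition pres_cl (t : gterm T) : pres := exist _ (pres_eq t) (ex_intro _ t erefl).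
Definition pres_repr (q : pres) : gterm T := sval (cid (svalP q)).

Lemma pres_clP s t : pres_cl s = pres_cl t <-> pres_eq s t.
Proof.
split=> [/(congr1 sval) /= st|st].
  by rewrite st; exact: pres_refl.
have E : pres_eq s = pres_eq t.
  apply/funext => u; apply/propext; split=> h; last exact: pres_trans h.
  exact: pres_trans (pres_sym st) h.
rewrite /pres_cl; move: (ex_intro _ s _) => h; move: h; rewrite E => h.
by congr exist; exact: Prop_irrelevance.
Qed.

Lemma pres_reprK q : pres_cl (pres_repr q) = q.
Proof.
case: q => S hS; rewrite /pres_repr /=; case: (cid _) => t /= St.
by case: _ / (esym St) hS => hS; congr exist; exact: Prop_irrelevance.
Qed.

Lemma pres_ind (P : pres -> Prop) : (forall t, P (pres_cl t)) -> forall q, P q.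
Proof. by move=> Pt q; rewrite -(pres_reprK q). Qed.

Definition presD (p q : pres) : pres := pres_cl (gadd (pres_repr p) (pres_repr q)).
Definition presN (p : pres) : pres := pres_cl (gopp (pres_repr p)).

Lemma pres_reprP t : pres_eq (pres_repr (pres_cl t)) t.
Proof. by apply/pres_clP; exact: pres_reprK. Qed.

Lemma presDE s t : presD (pres_cl s) (pres_cl t) = pres_cl (gadd s t).
Proof. by apply/pres_clP; apply: pres_add; exact: pres_reprP. Qed.

Lemma presNE t : presN (pres_cl t) = pres_cl (gopp t).
Proof. by apply/pres_clP; apply: pres_opp; exact: pres_reprP. Qed.

Program Definition presented : abgroup :=
  @AbGroup pres (pres_cl gzero) presD presN _ _ _ _.
Next Obligation.
elim/pres_ind=> a; elim/pres_ind=> b; elim/pres_ind=> c; rewrite !presDE.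
by apply/pres_clP; exact: pres_addA.
Qed.
Next Obligation.
elim/pres_ind=> a; elim/pres_ind=> b; rewrite !presDE.
by apply/pres_clP; exact: pres_addC.
Qed.
Next Obligation.
by elim/pres_ind=> a; rewrite presDE; apply/pres_clP; exact: pres_add0.
Qed.
Next Obligation.
by elim/pres_ind=> a; rewrite presNE presDE; apply/pres_clP; exact: pres_addN.
Qed.
End Presentation.

(* What right modules over a ring and R Gamma-modules have in common: a module
   has underlying abelian groups (one, resp. one for each object), homomorphisms
   act on them, and exactness is tested on them. *)
Record module_cat := ModuleCat {
  mod_ob :> Type;
  mod_hom : mod_ob -> mod_ob -> Type;
  mod_pt : Type;
  mod_ev : mod_ob -> mod_pt -> zmodType;
  mod_app : forall M N : mod_ob, mod_hom M N ->
    forall i : mod_pt, mod_ev M i -> mod_ev N i;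
  mod_sum : mod_ob -> mod_ob -> mod_ob;
  mod_rank : Type;
  mod_free : mod_rank -> mod_ob }.

Section ModuleCategory.
Variable A : module_cat.

Definition mod_is_zero (M : A) : Prop := forall i (m : mod_ev M i), m = 0.

Definition mod_injective (M N : A) (f : mod_hom M N) : Prop :=
  forall i, injective (mod_app f (i := i)).

Definition mod_surjective (M N : A) (f : mod_hom M N) : Prop :=
  forall i n, exists m, mod_app f (i := i) m = n.

Definition mod_exact (M N P : A) (f : mod_hom M N) (g : mod_hom N P) : Prop :=
  forall i n, mod_app g n = 0 <-> exists m, mod_app f (i := i) m = n.

Definition mod_iso (M N : A) : Prop :=
  exists (f : mod_hom M N) (g : mod_hom N M),
    forall i, cancel (mod_app f (i := i)) (mod_app g (i := i)) /\
              cancel (mod_app g (i := i)) (mod_app f (i := i)).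

Definition short_exact (P0 P1 P2 : A) : Prop :=
  exists (f : mod_hom P0 P1) (g : mod_hom P1 P2),
    [/\ mod_injective f, mod_exact f g & mod_surjective g].

Definition fg_projective (P : A) : Prop :=
  exists (Q : A) (n : mod_rank A), mod_iso (mod_sum P Q) (mod_free n).

Record fg_proj := FGProj { fg_mod :> A; fg_modP : fg_projective fg_mod }.

Inductive K0_rel : gterm fg_proj -> gterm fg_proj -> Prop :=
| K0_iso (P Q : fg_proj) : mod_iso P Q -> K0_rel (ggen P) (ggen Q)
| K0_exact (P0 P1 P2 : fg_proj) : short_exact P0 P1 P2 ->
    K0_rel (gadd (gadd (ggen P0) (gopp (ggen P1))) (ggen P2)) gzero.

Definition K0 : abgroup := presented K0_rel.
Definition K0_cl (P : fg_proj) : K0 := pres_cl K0_rel (ggen P).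

(* 0 -> P_(n-1) -> ... -> P_0 -> M -> 0 *)
Record finite_resolution (M : A) := FiniteResolution {
  res_len : nat;
  res_ob : nat -> fg_proj;
  res_diff : forall k, mod_hom (res_ob k.+1) (res_ob k);
  res_aug : mod_hom (res_ob 0) M;
  res_vanish : forall k, (res_len <= k)%N -> mod_is_zero (res_ob k);
  res_aug_surj : mod_surjective res_aug;
  res_aug_exact : mod_exact (res_diff 0) res_aug;
  res_exact : forall k, mod_exact (res_diff k.+1) (res_diff k) }.

Definition res_class (M : A) (r : finite_resolution M) : K0 :=
  ab_sum (res_len r) (fun k =>
    if odd k then ab_opp (K0_cl (res_ob r k)) else K0_cl (res_ob r k)).

(* "M has a finite projective resolution and k = [M]"; the independence of [M]
   from the resolution is part of the assertion. *)
Definition is_class (M : A) (k : K0) : Prop :=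
  inhabited (finite_resolution M) /\
  forall r : finite_resolution M, res_class r = k.

End ModuleCategory.

(* Right modules over A are left modules over the converse ring A^c; the right
   action of a on m is (a : A^c) *: m. *)
Definition right_mod (A : pzRingType) : module_cat :=
  @ModuleCat (lmodType A^c) (fun M N => {linear M -> N}) unit (fun M _ => M)
    (fun M N f _ => f) (fun M N => (M * N)%type) nat (fun n => 'rV[A^c]_n).

Definition RG_mod (R : pzRingType) (C : category) : module_cat :=
  @ModuleCat (RG_module R C) (@RG_hom R C) C (fun M x => M x)
    (fun M N f x => f x) (@RG_sum R C) (seq C) (@RG_free R C).

Definition iso_class (C : category) : Type :=
  {S : C -> Prop | exists x, S = isomorphic x}.

Definition iso_cl (C : category) (x : C) : iso_class C :=
  exist _ (isomorphic x) (ex_intro _ x erefl).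

Definition iso_le (C : category) (c d : iso_class C) : Prop :=
  exists x y : C, [/\ iso_cl x = c, iso_cl y = d & inhabited (hom x y)].

Section QuasiFinite.
Variable C : category.

Definition isotropy (x y : C) (f : hom x y) : set (aut x) :=
  [set g | f <o> g = f].

Definition orbit (x y : C) (f : hom x y) : set (hom x y) :=
  [set f <o> (g : aut x) | g in [set: aut x]].

Definition quasi_finite : Prop :=
  (forall c : iso_class C, finite_set [set d | iso_le d c]) /\
  (forall x y : C, (forall f : hom x y, finite_set (isotropy f)) /\
                   finite_set (range (@orbit x y))).

(* #|` fset_set A| is the number of elements of a finite set A. *)
Definition isotropy_orders_invertible (R : pzRingType) : Prop :=
  forall (x y : C) (f : hom x y),
    exists r : R, (#|` fset_set (isotropy f)|)%:R * r = 1.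
End QuasiFinite.

Definition splitK0 (R : comPzRingType) (C : category) (rep : iso_class C -> C)
    : abgroup :=
  direct_sum (fun c => K0 (right_mod (group_ring R (aut (rep c))))).

(* Main.v *)
From HB Require Import structures.
From mathcomp Require Import all_boot all_order all_algebra.
From mathcomp Require Import finmap.
From mathcomp Require Import boolp classical_sets functions cardinality.
Require Import Defs.

Set Implicit Arguments.
Unset Strict Implicit.
Unset Printing Implicit Defensive.

Import GRing.Theory.
Local Open Scope ring_scope.
#[local] Obligation Tactic := idtac.

(** Why restriction is defined.  The right [aut x]-set [mor(x, y)] is a finite
    disjoint union of orbits [H \ aut x] with [H] finite of invertible order.
    Averaging over [H] splits the projection of [R[x]] onto the module of such an
    orbit ([average_act]), so [R mor(x, y)] is a finitely generated projective
    [R[x]]-module ([fg_projective_Res_mor]), and so is [Res_x P] for every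
    finitely generated projective [P] ([fg_projective_Res]).  Restriction is exact
    and [P] lives on finitely many isomorphism classes
    ([supported_fg_projective]), hence [Res] descends to K_0.

    Why inclusion is defined.  For a finitely generated projective [R[x]]-module
    [Q], the module [Ext Q], that is [Q (x) R mor(?, x)], is finitely generated
    projective ([fg_projective_Ext]), and it maps onto [I_x Q], to which it is
    equal on the class of [x].  The kernel lives on the finitely many classes
    strictly below [x].  A module living on finitely many classes is an iterated
    extension of modules living on one class: peel off maximal classes one after
    the other ([peel], [has_class_filtration]).  A module living on the class of
    [y] is [I_y] of its restriction to [y] ([Inc_Res]), and the restriction of
    [Ext Q] to [y] is finitely generated projective; so by induction on the number
    of classes below [x], the kernel, and then [I_x Q], has a finite projective
    resolution ([has_class_Inc]).

    Why the two are inverse to each other.  The same filtration, applied to a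
    finitely generated projective [P], gives [[P] = \sum_c [I_c Res_c P]].
    In the other direction, [Res_d I_c Q] is [Q] if [d = c] and [0] otherwise
    ([Res_Inc], [Res_Inc_zero]), and [Res] computes classes of resolved modules
    too, because it is exact and preserves projectivity ([Res_K0_has_class]).

    These arguments use that the class of a resolved module is independent of the
    resolution ([resolved_uniq], by Schanuel's lemma) and additive in short exact
    sequences ([resolvedD], by the horseshoe lemma).  Both facts are
    proved once, for every category of modules with the structure [abelian]. *)

(** * Abelian groups and homomorphisms out of K_0 *)

Section AbelianGroups.
Variable A : abgroup.
Implicit Types a b c d : A.

Lemma ab_addr0 a : ab_add a ab_zero = a.
Proof. by rewrite ab_addC ab_add0. Qed.

Lemma ab_addrN a : ab_add a (ab_opp a) = ab_zero.
Proof. by rewrite ab_addC ab_addN. Qed.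

Lemma ab_addKl a b : ab_add (ab_opp a) (ab_add a b) = b.
Proof. by rewrite ab_addA ab_addN ab_add0. Qed.

Lemma ab_addI a b c : ab_add a b = ab_add a c -> b = c.
Proof. by move=> E; rewrite -(ab_addKl a b) E ab_addKl. Qed.

Lemma ab_addACA a b c d :
  ab_add (ab_add a b) (ab_add c d) = ab_add (ab_add a c) (ab_add b d).
Proof.
by rewrite -!ab_addA; congr ab_add; rewrite !ab_addA (ab_addC b).
Qed.

Lemma ab_opp_unique a b : ab_add a b = ab_zero -> b = ab_opp a.
Proof. by move=> E; apply: (@ab_addI a); rewrite E ab_addrN. Qed.

Lemma ab_opp0 : ab_opp ab_zero = ab_zero :> A.
Proof. by symmetry; apply: ab_opp_unique; rewrite ab_add0. Qed.

Lemma ab_oppK a : ab_opp (ab_opp a) = a.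
Proof. by symmetry; apply: ab_opp_unique; rewrite ab_addN. Qed.

Lemma ab_oppD a b : ab_opp (ab_add a b) = ab_add (ab_opp a) (ab_opp b).
Proof. by symmetry; apply: ab_opp_unique; rewrite ab_addACA !ab_addrN ab_add0. Qed.

Lemma ab_sumS_alternating n (F : nat -> A) :
  ab_sum n.+1 (fun k => if odd k then ab_opp (F k) else F k) =
  ab_add (F 0%N)
    (ab_opp (ab_sum n (fun k => if odd k then ab_opp (F k.+1) else F k.+1))).
Proof.
elim: n => [|n /= ->] /=; first by rewrite ab_opp0 ab_addC.
rewrite ab_oppD ab_addA; congr ab_add.
by case: (odd n); rewrite /= ?ab_oppK.
Qed.

Section FiniteSums.
Variable J : Type.
Implicit Types (F H : J -> A) (s t : seq {classic J}).

Lemma ab_lsum0 s F : (forall j, j \in s -> F j = ab_zero) ->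
  ab_lsum s F = ab_zero.
Proof.
elim: s => //= j s IHs F0; rewrite F0 ?mem_head // ab_add0 IHs // => i si.
by rewrite F0 // inE si orbT.
Qed.

Lemma eq_ab_lsum s F H : (forall j, j \in s -> F j = H j) ->
  ab_lsum s F = ab_lsum s H.
Proof.
elim: s => //= j s IHs FH; rewrite FH ?mem_head // IHs // => i si.
by rewrite FH // inE si orbT.
Qed.

Lemma ab_lsumD s F H :
  ab_lsum s (fun j => ab_add (F j) (H j)) = ab_add (ab_lsum s F) (ab_lsum s H).
Proof.
by elim: s => /= [|j s ->]; rewrite ?ab_add0 // ab_addACA.
Qed.

Lemma ab_lsum_rem s F (j : {classic J}) : j \in s ->
  ab_lsum s F = ab_add (F j) (ab_lsum (rem j s) F).
Proof.
elim: s => //= i s IHs; rewrite inE; case: eqVneq => [->|ij] //= sj.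
rewrite (IHs sj) !ab_addA; congr ab_add.
exact: ab_addC.
Qed.

Lemma ab_lsum_single s F (j : {classic J}) : uniq s -> j \in s ->
  (forall i, i \in s -> i != j -> F i = ab_zero) -> ab_lsum s F = F j.
Proof.
move=> us sj F0; rewrite (ab_lsum_rem F sj) ab_lsum0 ?ab_addr0 // => i.
by rewrite mem_rem_uniq // inE => /andP[ij si]; exact: F0.
Qed.

(** A finite sum over a list that exhausts the support does not depend on the
    list. *)
Lemma ab_lsum_support s t F : uniq s -> uniq t ->
  (forall j, j \in s -> F j <> ab_zero -> j \in t) ->
  (forall j, j \in t -> F j <> ab_zero -> j \in s) -> ab_lsum s F = ab_lsum t F.
Proof.
elim: s t => [|j s IHs] t /=.
  move=> _ _ _ F0; rewrite ab_lsum0 // => j tj; apply: contrapT => Fj.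
  by move: (F0 _ tj Fj).
move=> /andP[sj us] ut st ts; have [Fj|Fj] := pselect (F j = ab_zero).
  rewrite Fj ab_add0; apply: IHs => // i si Fi.
    by apply: st => //; rewrite inE si orbT.
  by move: (ts _ si Fi); rewrite inE => /predU1P[ij|//]; rewrite ij in Fi.
have tj : j \in t by apply: st Fj; rewrite mem_head.
rewrite (ab_lsum_rem F tj); congr ab_add; apply: IHs => [//||i si Fi|i].
- exact: rem_uniq.
- rewrite mem_rem_uniq // inE; apply/andP; split.
    by apply: contraNneq sj => <-.
  by apply: st => //; rewrite inE si orbT.
- rewrite mem_rem_uniq // inE => /andP[ij ti] Fi.
  by move: (ts _ ti Fi); rewrite inE (negPf ij).
Qed.
End FiniteSums.
End AbelianGroups.

Section Homomorphisms.
Variables (A B : abgroup) (f : A -> B) (fH : is_hom f).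

Lemma hom_zero : f ab_zero = ab_zero.
Proof. by apply: (@ab_addI _ (f ab_zero)); rewrite -fH !ab_addr0. Qed.

Lemma hom_opp a : f (ab_opp a) = ab_opp (f a).
Proof. by apply: ab_opp_unique; rewrite -fH ab_addrN hom_zero. Qed.

Lemma hom_lsum J (s : seq J) (F : J -> A) :
  f (ab_lsum s F) = ab_lsum s (fun j => f (F j)).
Proof. by elim: s => /= [|j s IHs]; rewrite ?hom_zero // fH IHs. Qed.
End Homomorphisms.

Section K0UniversalProperty.
Variable A : module_cat.

Lemma K0_cl_iso (P Q : fg_proj A) : mod_iso P Q -> K0_cl P = K0_cl Q.
Proof. by move=> PQ; apply/pres_clP/pres_rel/K0_iso. Qed.

Lemma K0_cl_exact (P0 P1 P2 : fg_proj A) : short_exact P0 P1 P2 ->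
  K0_cl P1 = ab_add (K0_cl P0) (K0_cl P2).
Proof.
move=> h; set p0 := K0_cl P0; set p1 := K0_cl P1; set p2 := K0_cl P2.
have /ab_opp_unique : ab_add (ab_opp p1) (ab_add p0 p2) = ab_zero.
  rewrite ab_addA (ab_addC _ p0) -/p0 -/p1 -/p2 /p0 /p1 /p2.
  rewrite /= /K0_cl presNE !presDE.
  by apply/pres_clP/pres_rel/K0_exact.
by rewrite ab_oppK.
Qed.

Lemma K0_ind (P : K0 A -> Prop) :
  P ab_zero -> (forall a b, P a -> P b -> P (ab_add a b)) ->
  (forall a, P a -> P (ab_opp a)) -> (forall Q, P (K0_cl Q)) -> forall a, P a.
Proof.
move=> P0 PD PN Pcl; apply: pres_ind; elim=> [//|//|s IHs t IHt|t IHt].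
  by rewrite -presDE; exact: PD.
by rewrite -presNE; exact: PN.
Qed.

Lemma eq_K0_hom (B : abgroup) (f g : K0 A -> B) : is_hom f -> is_hom g ->
  (forall Q, f (K0_cl Q) = g (K0_cl Q)) -> f =1 g.
Proof.
move=> fH gH fg; elim/K0_ind => [|a b fga fgb|a fga|//].
- by rewrite !hom_zero.
- by rewrite fH gH fga fgb.
- by rewrite !hom_opp // fga.
Qed.

Fixpoint gterm_eval T (B : abgroup) (f : T -> B) (t : gterm T) : B :=
  match t with
  | gzero => ab_zero
  | ggen P => f P
  | gadd s t => ab_add (gterm_eval f s) (gterm_eval f t)
  | gopp t => ab_opp (gterm_eval f t)
  end.

Lemma K0_lift (B : abgroup) (f : fg_proj A -> B) :
  (forall P Q : fg_proj A, mod_iso P Q -> f P = f Q) ->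
  (forall P0 P1 P2 : fg_proj A, short_exact P0 P1 P2 ->
     f P1 = ab_add (f P0) (f P2)) ->
  exists F : K0 A -> B, is_hom F /\ forall P, F (K0_cl P) = f P.
Proof.
move=> f_iso f_exact.
have evE s t : pres_eq (@K0_rel A) s t -> gterm_eval f s = gterm_eval f t.
  elim=> {s t} //= [s t [P Q PQ|P0 P1 P2 P012]|s t u _ -> _ ->|s s' t t' _ -> _ ->
    |s s' _ ->|s t u|s t|t|t] //=.
  - exact: f_iso.
  - rewrite (f_exact _ _ _ P012) -ab_addA (ab_addC (ab_opp _)) ab_addA.
    exact: ab_addrN.
  - exact: ab_addA.
  - exact: ab_addC.
  - exact: ab_add0.
  - exact: ab_addN.
pose F (a : K0 A) := gterm_eval f (pres_repr a).
have FE t : F (pres_cl _ t) = gterm_eval f t by apply/evE/pres_reprP.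
exists F; split=> [|P]; last exact: FE.
by apply: pres_ind => s; apply: pres_ind => t; rewrite /= presDE !FE.
Qed.
End K0UniversalProperty.

(** * Homological algebra in a category of modules *)
Reserved Notation "f $ x" (at level 11, x at next level).
Local Notation "f $ x" := (mod_app f x).

(** The structure on a category of modules from which the K-theory of finite
    resolutions is developed, for group rings and for category rings alike.
    [mod_factor] says that an injective homomorphism has the universal property of
    the inclusion of its image; inverses of bijective homomorphisms and maps into
    kernels both come from it. *)
Record abelian (A : module_cat) := Abelian {
  mid : forall M : A, mod_hom M M;
  mcomp : forall L M N : A, mod_hom M N -> mod_hom L M -> mod_hom L N;
  msub : forall M N : A, mod_hom M N -> mod_hom M N -> mod_hom M N;
  mzero : forall M N : A, mod_hom M N;
  minl : forall M N : A, mod_hom M (mod_sum M N);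
  minr : forall M N : A, mod_hom N (mod_sum M N);
  mfst : forall M N : A, mod_hom (mod_sum M N) M;
  msnd : forall M N : A, mod_hom (mod_sum M N) N;
  mod_appB : forall (M N : A) (f : mod_hom M N) i (a b : mod_ev M i),
    f $ (a - b) = f $ a - f $ b;
  midE : forall (M : A) i (m : mod_ev M i), mid M $ m = m;
  mcompE : forall (L M N : A) (g : mod_hom M N) (f : mod_hom L M) i
    (l : mod_ev L i), mcomp g f $ l = g $ (f $ l);
  msubE : forall (M N : A) (f g : mod_hom M N) i (m : mod_ev M i),
    msub f g $ m = f $ m - g $ m;
  mzeroE : forall (M N : A) i (m : mod_ev M i), mzero M N $ m = 0;
  mfst_inl : forall (M N : A) i (m : mod_ev M i), mfst M N $ (minl M N $ m) = m;
  mfst_inr : forall (M N : A) i (n : mod_ev N i), mfst M N $ (minr M N $ n) = 0;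
  msnd_inl : forall (M N : A) i (m : mod_ev M i), msnd M N $ (minl M N $ m) = 0;
  msnd_inr : forall (M N : A) i (n : mod_ev N i), msnd M N $ (minr M N $ n) = n;
  msum_eta : forall (M N : A) i (z : mod_ev (mod_sum M N) i),
    minl M N $ (mfst M N $ z) + minr M N $ (msnd M N $ z) = z;
  mod_kernel : forall (M N : A) (f : mod_hom M N),
    exists (K : A) (k : mod_hom K M), mod_injective k /\ mod_exact k f;
  mod_factor : forall (K L M : A) (k : mod_hom K M) (g : mod_hom L M),
    mod_injective k ->
    (forall i (l : mod_ev L i), exists x : mod_ev K i, k $ x = g $ l) ->
    exists h : mod_hom L K, forall i (l : mod_ev L i), k $ (h $ l) = g $ l;
  mod_free_lift : forall n (M N : A) (p : mod_hom M N)
    (h : mod_hom (mod_free n) N), mod_surjective p ->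
    exists h' : mod_hom (mod_free n) M,
      forall i (x : mod_ev (mod_free n) i), p $ (h' $ x) = h $ x;
  mod_free_sum : forall m n : mod_rank A,
    exists k, mod_iso (mod_sum (mod_free m) (mod_free n)) (mod_free k);
  mod_free_zero : exists n : mod_rank A, mod_is_zero (mod_free n) }.

Section HomologicalAlgebra.
Variables (A : module_cat) (H : abelian A).
Implicit Types K L M N X : A.

Lemma app0 M N (f : mod_hom M N) i : f $ (0 : mod_ev M i) = 0.
Proof. by rewrite -(subrr 0) (mod_appB H) subrr. Qed.

Lemma appN M N (f : mod_hom M N) i (a : mod_ev M i) : f $ (- a) = - (f $ a).
Proof. by rewrite -sub0r (mod_appB H) app0 sub0r. Qed.

Lemma appD M N (f : mod_hom M N) i (a b : mod_ev M i) :
  f $ (a + b) = f $ a + f $ b.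
Proof. by rewrite -{1}[b]opprK (mod_appB H) appN opprK. Qed.

Definition madd M N (f g : mod_hom M N) : mod_hom M N :=
  msub H f (msub H (mzero H M N) g).

Lemma maddE M N (f g : mod_hom M N) i (m : mod_ev M i) :
  madd f g $ m = f $ m + g $ m.
Proof. by rewrite /madd !msubE mzeroE sub0r opprK. Qed.

Lemma injective_ker0 M N (f : mod_hom M N) :
  (forall i (m : mod_ev M i), f $ m = 0 -> m = 0) -> mod_injective f.
Proof.
move=> f0 i a b E; apply/eqP; rewrite -subr_eq0; apply/eqP/f0.
by rewrite (mod_appB H) E subrr.
Qed.

Lemma bijective_iso M N (f : mod_hom M N) :
  mod_injective f -> mod_surjective f -> mod_iso M N.
Proof.
move=> fI fS.
have [i n|g gE] := @mod_factor A H M N N f (mid H N) fI.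
  by have [m <-] := fS i n; exists m; rewrite midE.
exists f, g => i; split=> m; last by rewrite gE midE.
by apply: fI; rewrite gE midE.
Qed.

Lemma iso_refl M : mod_iso M M.
Proof. by exists (mid H M), (mid H M) => i; split=> m; rewrite !midE. Qed.

Lemma iso_sym M N : mod_iso M N -> mod_iso N M.
Proof. by move=> [f [g fg]]; exists g, f => i; have [] := fg i. Qed.

Lemma iso_trans L M N : mod_iso L M -> mod_iso M N -> mod_iso L N.
Proof.
move=> [f [f' ff]] [g [g' gg]]; exists (mcomp H g f), (mcomp H f' g') => i.
have [fK f'K] := ff i; have [gK g'K] := gg i.
by split=> m; rewrite !mcompE ?gK ?fK ?f'K ?g'K.
Qed.

Lemma iso_zero M N : mod_is_zero M -> mod_is_zero N -> mod_iso M N.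
Proof.
move=> M0 N0; exists (mzero H M N), (mzero H N M) => i.
by split=> m; rewrite !mzeroE ?(M0 i m) ?(N0 i m).
Qed.

Lemma short_exact_iso L M N L' M' N' : short_exact L M N -> mod_iso L L' ->
  mod_iso M M' -> mod_iso N N' -> short_exact L' M' N'.
Proof.
move=> [f [g [fI fg gS]]] [a [a' aa]] [b [b' bb]] [c [c' cc]].
exists (mcomp H b (mcomp H f a')), (mcomp H c (mcomp H g b')).
split=> i.
- have [aK a'K] := aa i; have [bK b'K] := bb i.
  by move=> x y; rewrite !mcompE => /(can_inj bK)/fI/(can_inj a'K).
- have [aK a'K] := aa i; have [bK b'K] := bb i; have [cK c'K] := cc i.
  move=> n; rewrite !mcompE; split=> [E|[m <-]].
    have /fg[m mE] : g $ (b' $ n) = 0.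
      by apply: (can_inj cK); rewrite E app0.
    by exists (a $ m); rewrite !mcompE aK mE b'K.
  rewrite !mcompE bK.
  have -> : g $ (f $ (a' $ m)) = 0 by apply/fg; exists (a' $ m).
  exact: app0.
- have [bK b'K] := bb i; have [cK c'K] := cc i.
  move=> n; have [m mE] := gS i (c' $ n).
  by exists (b $ m); rewrite !mcompE bK mE c'K.
Qed.

(** The kernel of the retraction is a complement. *)
Lemma fg_projP M : fg_projective M <->
  exists n (s : mod_hom M (mod_free n)) (p : mod_hom (mod_free n) M),
    forall i (m : mod_ev M i), p $ (s $ m) = m.
Proof.
split=> [[Q [n [f [g fg]]]]|[n [s [p ps]]]].
  exists n, (mcomp H f (minl H M Q)), (mcomp H (mfst H M Q) g) => i m.
  by rewrite !mcompE; have [-> _] := fg i; rewrite mfst_inl.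
have [K [k [kI kp]]] := mod_kernel H p; exists K, n.
apply: (@bijective_iso _ _ (madd (mcomp H s (mfst H M K))
                                 (mcomp H k (msnd H M K)))).
  apply: injective_ker0 => i z; rewrite maddE !mcompE => E.
  have pk (x : mod_ev K i) : p $ (k $ x) = 0 by apply/kp; exists x.
  have z1 : mfst H M K $ z = 0.
    by have := congr1 (fun v => p $ v) E; rewrite /= appD ps pk addr0 app0.
  have z2 : msnd H M K $ z = 0.
    by apply: kI; rewrite app0 -E z1 app0 add0r.
  by rewrite -[LHS](msum_eta H) z1 z2 !app0 addr0.
move=> i n'.
have /kp[x xE] : p $ (n' - s $ (p $ n')) = 0 by rewrite (mod_appB H) ps subrr.
exists (minl H M K $ (p $ n') + minr H M K $ x).
by rewrite maddE !mcompE !appD mfst_inl mfst_inr msnd_inl msnd_inr !app0 addr0 add0r xE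
  addrC subrK.
Qed.

Lemma fg_projective_retract M P (s : mod_hom M P) (p : mod_hom P M) :
  fg_projective P -> (forall i (m : mod_ev M i), p $ (s $ m) = m) ->
  fg_projective M.
Proof.
move=> /fg_projP[n [s' [p' ps']]] ps; apply/fg_projP.
by exists n, (mcomp H s' s), (mcomp H p p') => i m; rewrite !mcompE ps'.
Qed.

Lemma fg_projective_iso M N : mod_iso M N -> fg_projective M -> fg_projective N.
Proof.
move=> [f [g fg]] Mp; apply: (fg_projective_retract (s := g) (p := f) Mp) => i m.
by have [_ ->] := fg i.
Qed.

Lemma fg_projective_free n : fg_projective (mod_free n : A).
Proof. by apply/fg_projP; exists n, (mid H _), (mid H _) => i m; rewrite !midE. Qed.

Lemma fg_projective_zero M : mod_is_zero M -> fg_projective M.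
Proof.
move=> M0; have [n n0] := mod_free_zero H.
exact: fg_projective_iso (iso_zero n0 M0) (fg_projective_free n).
Qed.

Lemma fg_projective_sum M N :
  fg_projective M -> fg_projective N -> fg_projective (mod_sum M N).
Proof.
move=> /fg_projP[m [s [p ps]]] /fg_projP[n [t [q qt]]].
have [k /iso_sym mnk] := mod_free_sum H m n.
pose F := mod_sum (mod_free m : A) (mod_free n).
have F_fgp : fg_projective F by apply: fg_projective_iso mnk (fg_projective_free k).
apply: (@fg_projective_retract _ _
  (madd (mcomp H (minl H _ _) (mcomp H s (mfst H M N)))
        (mcomp H (minr H _ _) (mcomp H t (msnd H M N))))
  (madd (mcomp H (minl H _ _) (mcomp H p (mfst H _ _)))
        (mcomp H (minr H _ _) (mcomp H q (msnd H _ _)))) F_fgp) => i z.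
rewrite !maddE !mcompE !appD !mfst_inl !mfst_inr !msnd_inl !msnd_inr.
by rewrite !app0 addr0 add0r ps qt msum_eta.
Qed.

(** A decomposition of the identity of [M] through two finitely generated
    projective modules exhibits [M] as a retract of their sum. *)
Lemma fg_projective_split M N P (i1 : mod_hom N M) (p1 : mod_hom M N)
    (i2 : mod_hom P M) (p2 : mod_hom M P) :
  fg_projective N -> fg_projective P ->
  (forall i (m : mod_ev M i), i1 $ (p1 $ m) + i2 $ (p2 $ m) = m) ->
  fg_projective M.
Proof.
move=> Np Pp E; apply: (@fg_projective_retract _ _
  (madd (mcomp H (minl H N P) p1) (mcomp H (minr H N P) p2))
  (madd (mcomp H i1 (mfst H N P)) (mcomp H i2 (msnd H N P)))
  (fg_projective_sum Np Pp)) => i m.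
rewrite !maddE !mcompE !appD !mfst_inl !mfst_inr !msnd_inl !msnd_inr.
by rewrite !app0 ?addr0 ?add0r E.
Qed.

(** The [s k] and [p k] are the coordinates and the vectors of a dual basis; they
    assemble into a retraction of the sum of the [F k] onto [M]. *)
Lemma fg_projective_dual_basis M n (F : 'I_n -> A)
    (s : forall k, mod_hom M (F k)) (p : forall k, mod_hom (F k) M) :
  (forall k, fg_projective (F k)) ->
  (forall i (m : mod_ev M i), \sum_k p k $ (s k $ m) = m) ->
  fg_projective M.
Proof.
move=> Fp E.
suff [P [t [q [Pp qt]]]] : exists P (t : mod_hom M P) (q : mod_hom P M),
    fg_projective P /\
    forall i (m : mod_ev M i), q $ (t $ m) = \sum_k p k $ (s k $ m).
  by apply: (fg_projective_retract (s := t) (p := q) Pp) => i m; rewrite qt E.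
elim: n F s p Fp {E} => [|n IHn] F s p Fp.
  have [z z0] := mod_free_zero H; exists (mod_free z), (mzero H _ _), (mzero H _ _).
  split=> [|i m]; first exact: fg_projective_free.
  by rewrite big_ord0 !mzeroE.
pose w := widen_ord (leqnSn n).
have [P [t [q [Pp qt]]]] :=
  IHn (fun k => F (w k)) (fun k => s (w k)) (fun k => p (w k)) (fun k => Fp (w k)).
exists (mod_sum P (F ord_max)),
  (madd (mcomp H (minl H _ _) t) (mcomp H (minr H _ _) (s ord_max))),
  (madd (mcomp H q (mfst H _ _)) (mcomp H (p ord_max) (msnd H _ _))).
split=> [|i m]; first exact: fg_projective_sum.
rewrite big_ord_recr /= -qt !maddE !mcompE !appD !mfst_inl !mfst_inr !msnd_inl.
by rewrite !msnd_inr !app0 addr0 add0r.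
Qed.

Lemma fg_projective_lift P M N (p : mod_hom M N) (h : mod_hom P N) :
  fg_projective P -> mod_surjective p ->
  exists h' : mod_hom P M, forall i (x : mod_ev P i), p $ (h' $ x) = h $ x.
Proof.
move=> /fg_projP[n [s [q qs]]] pS.
have [h' h'E] := mod_free_lift H (mcomp H h q) pS.
by exists (mcomp H h' s) => i x; rewrite mcompE h'E mcompE qs.
Qed.

(** The sequence splits because its last term is projective. *)
Lemma fg_projective_extension L M N : short_exact L M N ->
  fg_projective L -> fg_projective N -> fg_projective M.
Proof.
move=> [f [g [fI fg gS]]] Lp Np.
have [s sE] := fg_projective_lift (mid H N) Np gS.
have [i m|r rE] := mod_factor H (g := msub H (mid H M) (mcomp H s g)) fI.
  by apply/fg; rewrite msubE mcompE midE (mod_appB H) sE midE subrr.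
apply: (@fg_projective_split _ _ _ f r s g Lp Np) => i m.
by rewrite rE msubE mcompE midE subrK.
Qed.

(** Schanuel's construction: two presentations of [M] have a common refinement,
    the pullback of [P] and [Q] over [M], whose two projections have as kernels
    the kernels of the opposite presentations. *)
Lemma pullback_exact K L M P Q : short_exact K P M -> short_exact L Q M ->
  exists X, short_exact K X Q /\ short_exact L X P.
Proof.
move=> [k [p [kI kp pS]]] [l [q [lI lq qS]]].
have [X [x [xI xE]]] := mod_kernel H (msub H (mcomp H p (mfst H P Q))
                                             (mcomp H q (msnd H P Q))).
have Xeq i (z : mod_ev X i) :
    p $ (mfst H P Q $ (x $ z)) = q $ (msnd H P Q $ (x $ z)).
  have /xE : exists y, x $ y = x $ z by exists z.
  by rewrite msubE !mcompE => /eqP; rewrite subr_eq0 => /eqP.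
have Xex i (a : mod_ev P i) (b : mod_ev Q i) : p $ a = q $ b ->
    exists z, x $ z = minl H P Q $ a + minr H P Q $ b.
  move=> ab; apply/xE; rewrite msubE !mcompE !appD !mfst_inl !mfst_inr.
  by rewrite !msnd_inl !msnd_inr !app0 addr0 add0r ab subrr.
exists X; split.
- have [i y|h hE] := mod_factor H (g := mcomp H (minl H P Q) k) xI.
    have [|z zE] := Xex i (k $ y) 0; last first.
      by exists z; rewrite zE app0 addr0 mcompE.
    by rewrite app0; apply/kp; exists y.
  exists h, (mcomp H (msnd H P Q) x); split.
  + apply: injective_ker0 => i y y0; apply: kI; rewrite app0.
    by rewrite -(mfst_inl H Q (k $ y)) -(mcompE H (minl H P Q)) -hE y0 !app0.
  + move=> i z; rewrite mcompE; split=> [z2|[y <-]]; last first.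
      by rewrite hE mcompE msnd_inl.
    have /kp[y yE] : p $ (mfst H P Q $ (x $ z)) = 0 by rewrite Xeq z2 app0.
    exists y; apply: xI; rewrite hE mcompE yE.
    by rewrite -[RHS](msum_eta H) z2 app0 addr0.
  + move=> i b; have [a ab] := pS i (q $ b); have [z zE] := Xex i a b ab.
    by exists z; rewrite mcompE zE appD msnd_inl msnd_inr add0r.
- have [i y|h hE] := mod_factor H (g := mcomp H (minr H P Q) l) xI.
    have [|z zE] := Xex i 0 (l $ y); last first.
      by exists z; rewrite zE app0 add0r mcompE.
    by rewrite app0; symmetry; apply/lq; exists y.
  exists h, (mcomp H (mfst H P Q) x); split.
  + apply: injective_ker0 => i y y0; apply: lI; rewrite app0.
    by rewrite -(msnd_inr H P (l $ y)) -(mcompE H (minr H P Q)) -hE y0 !app0.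
  + move=> i z; rewrite mcompE; split=> [z1|[y <-]]; last first.
      by rewrite hE mcompE mfst_inr.
    have /lq[y yE] : q $ (msnd H P Q $ (x $ z)) = 0 by rewrite -Xeq z1 app0.
    exists y; apply: xI; rewrite hE mcompE yE.
    by rewrite -[RHS](msum_eta H) z1 app0 add0r.
  + move=> i a; have [b ba] := qS i (p $ a); have [z zE] := Xex i a b (esym ba).
    by exists z; rewrite mcompE zE appD mfst_inl mfst_inr addr0.
Qed.

(** One step of the horseshoe lemma: the presentation of [M2] lifts to [M1] because
    [P2] is projective, and the snake lemma makes the kernels exact. *)
Lemma horseshoe M0 M1 M2 K0 P0 K2 P2 : short_exact M0 M1 M2 ->
  short_exact K0 P0 M0 -> short_exact K2 P2 M2 -> fg_projective P2 ->
  exists K1, short_exact K0 K1 K2 /\ short_exact K1 (mod_sum P0 P2) M1.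
Proof.
move=> [f [g [fI fg gS]]] [k0 [p0 [k0I kp0 p0S]]] [k2 [p2 [k2I kp2 p2S]]] P2p.
have [s sE] := fg_projective_lift p2 P2p gS.
pose h := madd (mcomp H f (mcomp H p0 (mfst H P0 P2))) (mcomp H s (msnd H P0 P2)).
have hE i (z : mod_ev (mod_sum P0 P2) i) :
    h $ z = f $ (p0 $ (mfst H P0 P2 $ z)) + s $ (msnd H P0 P2 $ z).
  by rewrite /h maddE !mcompE.
have gf i (m : mod_ev M0 i) : g $ (f $ m) = 0 by apply/fg; exists m.
have [K1 [k [kI kh]]] := mod_kernel H h.
have hS : mod_surjective h.
  move=> i m; have [b bE] := p2S i (g $ m).
  have /fg[m0 m0E] : g $ (m - s $ b) = 0 by rewrite (mod_appB H) sE bE subrr.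
  have [a aE] := p0S i m0.
  exists (minl H P0 P2 $ a + minr H P0 P2 $ b); rewrite hE !appD !mfst_inl !mfst_inr.
  by rewrite !msnd_inl !msnd_inr !app0 addr0 add0r aE m0E subrK.
exists K1; split; last by exists k, h.
have [i x|u uE] := mod_factor H (g := mcomp H (minl H P0 P2) k0) kI.
  apply/kh; rewrite hE mcompE mfst_inl msnd_inl app0 addr0.
  have -> : p0 $ (k0 $ x) = 0 by apply/kp0; exists x.
  exact: app0.
have [i y|v vE] := mod_factor H (g := mcomp H (msnd H P0 P2) k) k2I.
  apply/kp2; rewrite mcompE -sE.
  have /(congr1 (fun v => g $ v)) : h $ (k $ y) = 0 by apply/kh; exists y.
  by rewrite hE appD gf add0r app0.
exists u, v; split.
- apply: injective_ker0 => i x x0; apply: k0I; rewrite app0.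
  by rewrite -(mfst_inl H P2 (k0 $ x)) -(mcompE H (minl H P0 P2)) -uE x0 !app0.
- move=> i y; split=> [y0|[x <-]]; last first.
    by apply: k2I; rewrite vE mcompE uE mcompE msnd_inl app0.
  have y2 : msnd H P0 P2 $ (k $ y) = 0 by rewrite -(mcompE H) -vE y0 app0.
  have : h $ (k $ y) = 0 by apply/kh; exists y.
  rewrite hE y2 app0 addr0 -(app0 f i) => /fI/kp0[x xE].
  exists x; apply: kI; rewrite uE mcompE xE.
  by rewrite -[RHS](msum_eta H) y2 app0 addr0.
- move=> i z; have z0 : p2 $ (k2 $ z) = 0 by apply/kp2; exists z.
  have /fg[m0 m0E] : g $ (s $ (k2 $ z)) = 0 by rewrite sE z0.
  have [a aE] := p0S i m0.
  have /kh[y yE] : h $ (minl H P0 P2 $ (- a) + minr H P0 P2 $ (k2 $ z)) = 0.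
    rewrite hE !appD !mfst_inl !mfst_inr !msnd_inl !msnd_inr !app0 addr0 add0r.
    by rewrite !appN aE m0E addrC subrr.
  by exists y; apply: k2I; rewrite vE mcompE yE appD msnd_inl msnd_inr add0r.
Qed.

(** * Classes of modules with a finite projective resolution *)

(** A resolution built one syzygy at a time, together with its Euler
    characteristic.  The length is an index so that two resolutions can be padded
    to the same length and compared step by step. *)
Inductive resolved : nat -> A -> K0 A -> Prop :=
| resolved0 (P : fg_proj A) M : mod_iso P M -> resolved 0 M (K0_cl P)
| resolvedS n K (P : fg_proj A) M k : short_exact K P M -> resolved n K k ->
    resolved n.+1 M (ab_add (K0_cl P) (ab_opp k)).

Definition has_class M (k : K0 A) : Prop := exists n, resolved n M k.

Lemma K0_cl_zero (P : fg_proj A) : mod_is_zero P -> K0_cl P = ab_zero.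
Proof.
move=> P0; apply: (@ab_addI _ (K0_cl P)); rewrite ab_addr0; symmetry.
apply: K0_cl_exact; exists (mid H P), (mid H P).
split=> [i a b _|i n|i n]; first by rewrite (P0 i a) (P0 i b).
  by split=> _; rewrite ?midE ?(P0 i n) //; exists 0; rewrite midE.
by exists n; rewrite midE.
Qed.

Lemma short_exact_id (P Z : A) : mod_is_zero Z -> short_exact Z P P.
Proof.
move=> Z0; exists (mzero H Z P), (mid H P); split=> [i a b _|i n|i n].
- by rewrite (Z0 i a) (Z0 i b).
- rewrite midE; split=> [->|[m <-]]; last by rewrite mzeroE.
  by exists 0; rewrite mzeroE.
- by exists n; rewrite midE.
Qed.

Lemma resolved_pad n M k : resolved n M k -> resolved n.+1 M k.
Proof.
elim=> {n M k} [P M PM|n K P M k KPM _ IH]; last exact: resolvedS KPM IH.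
have [z z0] := mod_free_zero H; pose Z := FGProj (fg_projective_free z).
have -> : K0_cl P = ab_add (K0_cl P) (ab_opp (K0_cl Z)).
  by rewrite (K0_cl_zero (P := Z) z0) ab_opp0 ab_addr0.
apply: resolvedS (resolved0 (iso_refl _)).
exact: short_exact_iso (short_exact_id P z0) (iso_refl _) (iso_refl _) PM.
Qed.

Lemma resolved_le m n M k : (m <= n)%N -> resolved m M k -> resolved n M k.
Proof.
by move=> /subnK <-; elim: (n - m)%N => // d IHd /IHd; exact: resolved_pad.
Qed.

Lemma resolved_iso n M N k : mod_iso M N -> resolved n M k -> resolved n N k.
Proof.
move=> MN r; case: r MN => {n M k} [P M PM|n K P M k KPM r] MN.
  exact/resolved0/(iso_trans PM).
apply: resolvedS r; exact: short_exact_iso KPM (iso_refl _) (iso_refl _) MN.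
Qed.

Lemma resolved0_inv M k : resolved 0 M k ->
  exists P : fg_proj A, mod_iso P M /\ k = K0_cl P.
Proof.
move E: 0%N => n r; case: r E => {n M k} [P M PM _|//].
by exists P.
Qed.

Lemma resolvedS_inv n M k : resolved n.+1 M k -> exists K (P : fg_proj A) k',
  [/\ short_exact K P M, resolved n K k' & k = ab_add (K0_cl P) (ab_opp k')].
Proof.
move E: n.+1 => n' r; case: r E => {n' M k} [//|n' K P M k KPM r [->]].
by exists K, P, k.
Qed.

(** The horseshoe lemma turns resolutions of the outer terms into one of the
    middle term; at length [0] this is the defining relation of K_0. *)
Lemma resolvedD n M0 M1 M2 a b : short_exact M0 M1 M2 ->
  resolved n M0 a -> resolved n M2 b -> resolved n M1 (ab_add a b).
Proof.
elim: n M0 M1 M2 a b => [|n IHn] M0 M1 M2 a b M012.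
  move=> /resolved0_inv[P0 [PM0 ->]] /resolved0_inv[P2 [PM2 ->]].
  have P012 : short_exact P0 M1 P2.
    exact: short_exact_iso M012 (iso_sym PM0) (iso_refl _) (iso_sym PM2).
  have M1p := fg_projective_extension P012 (fg_modP P0) (fg_modP P2).
  rewrite -(K0_cl_exact (P1 := FGProj M1p) P012).
  exact/resolved0/iso_refl.
move=> /resolvedS_inv[K0 [P0 [k0 [KPM0 r0 ->]]]].
move=> /resolvedS_inv[K2 [P2 [k2 [KPM2 r2 ->]]]].
have [K1 [K012 K1M]] := horseshoe M012 KPM0 KPM2 (fg_modP P2).
pose P1 := FGProj (fg_projective_sum (fg_modP P0) (fg_modP P2)).
have P012 : short_exact P0 P1 P2.
  exists (minl H _ _), (msnd H _ _); split=> [i|i z|i c].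
  - exact: can_inj (@mfst_inl _ H _ _ i).
  - split=> [z2|[y <-]]; last by rewrite msnd_inl.
    by exists (mfst H P0 P2 $ z); rewrite -[RHS](msum_eta H) z2 app0 addr0.
  - by exists (minr H _ _ $ c); rewrite msnd_inr.
have := resolvedS (P := P1) K1M (IHn _ _ _ _ _ K012 r0 r2).
by rewrite (K0_cl_exact P012) ab_oppD ab_addACA.
Qed.

(** Let [K -> P -> M] and [L -> Q -> M] be the first steps.  Their pullback [X] is an
    extension of [Q] by [K] and of [P] by [L], so it is resolved in length [n] in
    two ways, and by induction [[K] + [Q] = [L] + [P]]. *)
Lemma resolved_uniq n M k k' : resolved n M k -> resolved n M k' -> k = k'.
Proof.
elim: n M k k' => [|n IHn] M k k'.
  move=> /resolved0_inv[P [PM ->]] /resolved0_inv[P' [PM' ->]].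
  exact/K0_cl_iso/(iso_trans PM)/iso_sym.
move=> /resolvedS_inv[K [P [a [KPM ra ->]]]].
move=> /resolvedS_inv[L [Q [b [LQM rb ->]]]].
have [X [KXQ LXP]] := pullback_exact KPM LQM.
have fgr (F : fg_proj A) : resolved n F (K0_cl F).
  exact: (resolved_le (leq0n n)) (resolved0 (iso_refl _)).
have E := IHn _ _ _ (resolvedD KXQ ra (fgr Q)) (resolvedD LXP rb (fgr P)).
apply: (@ab_addI _ b); rewrite !ab_addA -E (ab_addC a) (ab_addC b).
by rewrite -!ab_addA !ab_addrN.
Qed.

Lemma has_class_uniq M k k' : has_class M k -> has_class M k' -> k = k'.
Proof.
move=> [m rm] [n rn]; apply: (@resolved_uniq (maxn m n) M).
  exact: resolved_le (leq_maxl _ _) rm.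
exact: resolved_le (leq_maxr _ _) rn.
Qed.

Lemma has_classD M0 M1 M2 a b : short_exact M0 M1 M2 ->
  has_class M0 a -> has_class M2 b -> has_class M1 (ab_add a b).
Proof.
move=> M012 [m rm] [n rn]; exists (maxn m n); apply: resolvedD M012 _ _.
  exact: resolved_le (leq_maxl _ _) rm.
exact: resolved_le (leq_maxr _ _) rn.
Qed.

Lemma has_class_iso M N k : mod_iso M N -> has_class M k -> has_class N k.
Proof. by move=> MN [n /(resolved_iso MN) r]; exists n. Qed.

Lemma has_class_fg_proj (P : fg_proj A) : has_class P (K0_cl P).
Proof. by exists 0%N; exact/resolved0/iso_refl. Qed.

Lemma has_class_zero M : mod_is_zero M -> has_class M ab_zero.
Proof.
move=> M0; rewrite -(K0_cl_zero (P := FGProj (fg_projective_zero M0)) M0).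
exact: has_class_fg_proj (FGProj _).
Qed.

(** Resolutions of the first syzygy are spliced with its inclusion into [P]. *)
Lemma resolved_resolution n M k : resolved n M k ->
  exists r : finite_resolution M, res_class r = k.
Proof.
elim=> {n M k} [P M [f [g fg]]|n K P M k [i [p [iI ip pS]]] _ [r <-]].
  have [z z0] := mod_free_zero H; pose Z := FGProj (fg_projective_free z).
  pose ob k := if k is _.+1 then Z else P.
  have fI i : injective (mod_app f (i := i)) by have [/can_inj] := fg i.
  unshelve eexists (@FiniteResolution A M 1 ob (fun k => mzero H Z (ob k)) f
    _ _ _ _) => //=.
  - by case.
  - by move=> i m; exists (g $ m); have [_ ->] := fg i.
  - move=> i m; split=> [|[x <-]]; last by rewrite mzeroE app0.
    by rewrite -(app0 f i) => /fI ->; exists 0; rewrite mzeroE.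
  - move=> k i m; split=> [_|_]; last by rewrite mzeroE.
    by exists 0; rewrite mzeroE (z0 i m).
  - exact: (ab_add0 (K0_cl P)).
pose ob j := if j is j'.+1 then res_ob r j' else P.
pose d j : mod_hom (ob j.+1) (ob j) :=
  match j return mod_hom (ob j.+1) (ob j) with
  | 0 => mcomp H i (res_aug r)
  | j'.+1 => res_diff r j'
  end.
unshelve eexists (@FiniteResolution A M (res_len r).+1 ob d p _ _ _ _) => //=.
- by case=> // j; exact: res_vanish.
- move=> j n'; split=> [/ip[y yE]|[m <-]]; last first.
    by rewrite mcompE; apply/ip; eexists.
  have [m mE] := res_aug_surj r y.
  by exists m; rewrite mcompE mE.
- case=> [|l] j x; last exact: res_exact.
  rewrite /= mcompE; split=> [|/res_aug_exact ->]; last exact: app0.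
  by rewrite -(app0 i j) => /iI/res_aug_exact.
- rewrite /res_class /=.
  rewrite -[RHS](ab_sumS_alternating _ (fun j => K0_cl (ob j))).
  by [].
Qed.

(** Conversely, truncating a resolution leaves a shorter one of the kernel of the
    augmentation. *)
Lemma resolution_has_class M (r : finite_resolution M) : has_class M (res_class r).
Proof.
rewrite /res_class; case: r => n ob d p van pS pE ex /=.
elim: n M ob d p van pS pE ex => [|n IHn] M ob d p van pS pE ex /=.
  apply: has_class_zero => i m; have [x <-] := pS i m.
  by rewrite (van 0%N (leqnn _) i x) app0.
have [K [k [kI kp]]] := mod_kernel H p.
have [i y|q qE] := mod_factor H (g := d 0%N) kI.
  by apply/kp/pE; exists y.
have [||m r] := IHn K (fun j => ob j.+1) (fun j => d j.+1) q
  (fun j => van j.+1) _ _ (fun j => ex j.+1).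
- move=> i y; have /pE[x xE] : p $ (k $ y) = 0 by apply/kp; exists y.
  by exists x; apply: kI; rewrite qE.
- move=> i x; rewrite -ex -qE; split=> [->|]; first exact: app0.
  by rewrite -(app0 k i) => /kI.

exists m.+1.
rewrite [X in resolved _ _ X](ab_sumS_alternating n (fun j => K0_cl (ob j))).
by apply: resolvedS r; exists k, p.
Qed.

Lemma has_class_is_class M k : has_class M k -> is_class M k.
Proof.
move=> Mk; split; last first.
  by move=> r; exact: has_class_uniq (resolution_has_class r) Mk.
by have [n /resolved_resolution[r _]] := Mk.
Qed.
End HomologicalAlgebra.

(** * Right modules over a ring *)
Section LinearMaps.
Variable R : pzRingType.
Implicit Types U V W : lmodType R.

Section Kernel.
Variables (V W : lmodType R) (f : {linear V -> W}).

Definition ker_pred : {pred V} := [pred v | f v == 0].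

Lemma ker_closed : subsemimod_closed ker_pred.
Proof.
split; first split.
- by rewrite inE linear0.
- by move=> u v; rewrite !inE linearD => /eqP -> /eqP ->; rewrite addr0.
- by move=> a v; rewrite !inE linearZZ => /eqP ->; rewrite scaler0.
Qed.

HB.instance Definition _ := GRing.isSubmodClosed.Build R V ker_pred ker_closed.

Record linker := LinKer { linker_val : V; _ : linker_val \in ker_pred }.

HB.instance Definition _ := [isSub for linker_val].
HB.instance Definition _ := [Choice of linker by <:].
HB.instance Definition _ := [SubChoice_isSubLmodule of linker by <:].

Lemma linker_val_linear : linear linker_val.
Proof. by []. Qed.
HB.instance Definition _ :=
  GRing.isLinear.Build R linker V *:%R linker_val linker_val_linear.

Lemma linker_valP (k : linker) : f (linker_val k) = 0.
Proof. by case: k => v /= /eqP. Qed.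

Lemma linker_exact v : f v = 0 <-> exists k : linker, linker_val k = v.
Proof.
split=> [/eqP fv|[k <-]]; last exact: linker_valP.
by exists (@LinKer v fv).
Qed.
End Kernel.

Lemma linear_kernel V W (f : {linear V -> W}) :
  exists (K : lmodType R) (k : {linear K -> V}),
    injective k /\ forall v, f v = 0 <-> exists x, k x = v.
Proof.
exists (linker f), (@linker_val V W f).
by split=> [|v]; [exact: val_inj | exact: linker_exact].
Qed.

Lemma linear_factor U V W (k : {linear U -> W}) (g : {linear V -> W}) :
  injective k -> (forall v, exists u, k u = g v) ->
  exists h : {linear V -> U}, forall v, k (h v) = g v.
Proof.
move=> kI kg; pose h v := sval (cid (kg v)).
have hE v : k (h v) = g v by exact: svalP (cid (kg v)).
have h_linear : linear h by move=> a u v; apply: kI; rewrite linearP !hE linearP.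
exists (HB.pack_for {linear V -> U} h (GRing.isLinear.Build _ _ _ _ _ h_linear)).
exact: hE.
Qed.

Definition pair_inl V W (v : V) : V * W := (v, 0).
Definition pair_inr V W (w : W) : V * W := (0, w).

Lemma pair_inl_linear V W : linear (@pair_inl V W).
Proof. by move=> a u v; congr pair; rewrite /= scaler0 addr0. Qed.
HB.instance Definition _ V W :=
  GRing.isLinear.Build R V (V * W)%type *:%R (@pair_inl V W) (@pair_inl_linear V W).

Lemma pair_inr_linear V W : linear (@pair_inr V W).
Proof. by move=> a u v; congr pair; rewrite /= scaler0 addr0. Qed.
HB.instance Definition _ V W :=
  GRing.isLinear.Build R W (V * W)%type *:%R (@pair_inr V W) (@pair_inr_linear V W).
End LinearMaps.

Section RightModules.
Variable A : pzRingType.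

Section RowExtension.
Variables (n : nat) (V : lmodType A^c) (b : 'I_n -> V).

Definition row_ext (v : 'rV[A^c]_n) : V := \sum_j v 0 j *: b j.

Lemma row_ext_linear : linear row_ext.
Proof.
move=> a u v; rewrite /row_ext scaler_sumr -big_split /=; apply: eq_bigr => j _.
by rewrite !mxE scalerDl scalerA.
Qed.
HB.instance Definition _ := GRing.isLinear.Build A^c 'rV[A^c]_n V *:%R
  row_ext row_ext_linear.
End RowExtension.

Lemma right_mod_row_lift n (M N : lmodType A^c) (p : {linear M -> N})
    (h : {linear 'rV[A^c]_n -> N}) : (forall y, exists x, p x = y) ->
  exists h' : {linear 'rV[A^c]_n -> M}, forall v, p (h' v) = h v.
Proof.
move=> pS; pose b j := sval (cid (pS (h (delta_mx 0 j)))).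
exists (row_ext b) => v.
rewrite {2}(row_sum_delta v) /= /row_ext !linear_sum /=; apply: eq_bigr => j _.
by rewrite !linearZZ; congr (_ *: _); exact: svalP (cid (pS _)).
Qed.

Lemma row_sum_iso m n :
  exists (f : {linear ('rV[A^c]_m * 'rV[A^c]_n)%type -> 'rV[A^c]_(m + n)})
         (g : {linear 'rV[A^c]_(m + n) -> ('rV[A^c]_m * 'rV[A^c]_n)%type}),
    cancel f g /\ cancel g f.
Proof.
have f_linear : linear (fun p : 'rV[A^c]_m * 'rV[A^c]_n => row_mx p.1 p.2).
  by move=> a p q; rewrite scale_row_mx add_row_mx.
have g_linear : linear (fun v : 'rV[A^c]_(m + n) => (lsubmx v, rsubmx v)).
  by move=> a u v; congr pair; apply/rowP => j; rewrite !mxE.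
pose f : {linear ('rV[A^c]_m * 'rV[A^c]_n)%type -> 'rV[A^c]_(m + n)} :=
  HB.pack (fun p : 'rV[A^c]_m * 'rV[A^c]_n => row_mx p.1 p.2)
    (GRing.isLinear.Build _ _ _ _ _ f_linear).
pose g : {linear 'rV[A^c]_(m + n) -> ('rV[A^c]_m * 'rV[A^c]_n)%type} :=
  HB.pack (fun v : 'rV[A^c]_(m + n) => (lsubmx v, rsubmx v))
    (GRing.isLinear.Build _ _ _ _ _ g_linear).
exists f, g; split=> [[u v]|v] /=; last exact: hsubmxK.
by rewrite row_mxKl row_mxKr.
Qed.

Program Definition right_mod_abelian : abelian (right_mod A) :=
  @Abelian (right_mod A)
    (fun M => (idfun : {linear M -> M}))
    (fun L M N (g : {linear M -> N}) (f : {linear L -> M}) =>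
       (g \o f : {linear L -> N}))
    (fun M N (f g : {linear M -> N}) => (f \- g : {linear M -> N}))
    (fun M N => (\0 : {linear M -> N}))
    (fun M N => (@pair_inl _ M N : {linear M -> (M * N)%type}))
    (fun M N => (@pair_inr _ M N : {linear N -> (M * N)%type}))
    (fun M N => (fst : {linear (M * N)%type -> M}))
    (fun M N => (snd : {linear (M * N)%type -> N}))
    _ _ _ _ _ _ _ _ _ _ _ _ _ _ _.
Next Obligation. by move=> M N f i a b; exact: (raddfB (f : {linear M -> N})). Qed.
Next Obligation. by []. Qed.
Next Obligation. by []. Qed.
Next Obligation. by []. Qed.
Next Obligation. by []. Qed.
Next Obligation. by []. Qed.
Next Obligation. by []. Qed.
Next Obligation. by []. Qed.
Next Obligation. by []. Qed.
Next Obligation.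
by move=> M N i [m n]; congr pair; rewrite /= ?addr0 ?add0r.
Qed.
Next Obligation.
move=> M N f; have [K [k [kI kf]]] := linear_kernel f.
by exists K, k; split=> i.
Qed.
Next Obligation.
move=> K L M k g kI kg; have [h hE] := linear_factor (kI tt) (kg tt).
by exists h => i.
Qed.
Next Obligation.
move=> n M N p h pS; have [h' h'E] := right_mod_row_lift h (pS tt).
by exists h' => i.
Qed.
Next Obligation.
move=> m n; exists (m + n)%N; have [f [g fg]] := row_sum_iso m n.
by exists f, g => i.
Qed.
Next Obligation. by exists 0%N => i v; exact: thinmx0. Qed.
End RightModules.

(** * Modules over a category *)
Section KernelMap.
Variables (R : pzRingType) (V W V' W' : lmodType R).
Variables (f : {linear V -> W}) (f' : {linear V' -> W'}).
Variables (u : {linear V -> V'}) (w : {linear W -> W'}).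
Hypothesis uw : forall v, f' (u v) = w (f v).

Lemma linker_map_subproof (k : linker f) : u (linker_val k) \in ker_pred f'.
Proof. by rewrite inE uw linker_valP linear0. Qed.

Definition linker_map (k : linker f) : linker f' :=
  LinKer (linker_map_subproof k).

Lemma linker_map_linear : linear linker_map.
Proof. by move=> a k l; apply: val_inj => /=; rewrite linearP. Qed.
HB.instance Definition _ := GRing.isLinear.Build R (linker f) (linker f') *:%R
  linker_map linker_map_linear.
End KernelMap.

Section RGModules.
Variables (R : comPzRingType) (C : category).
Implicit Types L M N P : RG_module R C.

Section Homs.
Variables L M N : RG_module R C.

Program Definition RG_id : RG_hom M M := @RGHom R C M M (fun y => idfun) _.
Next Obligation. by []. Qed.

Program Definition RG_comp (g : RG_hom M N) (f : RG_hom L M) : RG_hom L N :=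
  @RGHom R C L N (fun y => (g y \o f y : {linear _ -> _})) _.
Next Obligation. by move=> g f y z h m /=; rewrite !hom_natural. Qed.

Program Definition RG_sub (f g : RG_hom M N) : RG_hom M N :=
  @RGHom R C M N (fun y => (f y \- g y : {linear _ -> _})) _.
Next Obligation. by move=> f g y z h m /=; rewrite !hom_natural linearB. Qed.

Program Definition RG_hom0 : RG_hom M N :=
  @RGHom R C M N (fun y => (\0 : {linear _ -> _})) _.
Next Obligation. by move=> y z h m /=; rewrite linear0. Qed.

Program Definition RG_inl : RG_hom M (RG_sum M N) :=
  @RGHom R C M (RG_sum M N) (fun y => @pair_inl R (M y) (N y)) _.
Next Obligation.
by move=> y z h m; rewrite /pair_inl /= /pair_map /= linear0.
Qed.

Program Definition RG_inr : RG_hom N (RG_sum M N) :=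
  @RGHom R C N (RG_sum M N) (fun y => @pair_inr R (M y) (N y)) _.
Next Obligation.
by move=> y z h m; rewrite /pair_inr /= /pair_map /= linear0.
Qed.

Program Definition RG_fst : RG_hom (RG_sum M N) M :=
  @RGHom R C (RG_sum M N) M (fun y => (fst : {linear (M y * N y)%type -> M y})) _.
Next Obligation. by []. Qed.

Program Definition RG_snd : RG_hom (RG_sum M N) N :=
  @RGHom R C (RG_sum M N) N (fun y => (snd : {linear (M y * N y)%type -> N y})) _.
Next Obligation. by []. Qed.

Definition RG_pair_at (f : RG_hom L M) (g : RG_hom L N) y (l : L y) :
  M y * N y := (f y l, g y l).

Lemma RG_pair_linear f g y : linear (@RG_pair_at f g y).
Proof. by move=> a u v; congr pair; rewrite linearP. Qed.
HB.instance Definition _ f g y := GRing.isLinear.Build R (L y) (M y * N y)%type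
  *:%R (@RG_pair_at f g y) (@RG_pair_linear f g y).

Program Definition RG_pair (f : RG_hom L M) (g : RG_hom L N) :
    RG_hom L (RG_sum M N) :=
  @RGHom R C L (RG_sum M N) (fun y => @RG_pair_at f g y) _.
Next Obligation.
by move=> f g y z h l; apply: (f_equal2 pair); exact: hom_natural.
Qed.

Program Definition RG_ker (f : RG_hom M N) : RG_module R C :=
  @RGModule R C (fun y => linker (f y))
    (fun y z h => linker_map (hom_natural f h)) _ _.
Next Obligation. by move=> f y k; apply: val_inj; exact: mod_map_id. Qed.
Next Obligation.
by move=> f y z w g h k; apply: val_inj; exact: mod_map_comp.
Qed.

Program Definition RG_ker_incl (f : RG_hom M N) : RG_hom (RG_ker f) M :=
  @RGHom R C (RG_ker f) M (fun y => @linker_val R _ _ (f y)) _.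
Next Obligation. by []. Qed.
End Homs.

Lemma RG_factor K L M (k : RG_hom K M) (g : RG_hom L M) :
  (forall y, injective (k y)) -> (forall y l, exists x, k y x = g y l) ->
  exists h : RG_hom L K, forall y l, k y (h y l) = g y l.
Proof.
move=> kI kg; pose h y := sval (cid (linear_factor (kI y) (kg y))).
have hE y l : k y (h y l) = g y l.
  exact: svalP (cid (linear_factor (kI y) (kg y))) l.
have h_nat y z (f : hom y z) l : h y (mod_map L f l) = mod_map K f (h z l).
  by apply: (kI y); rewrite hE !hom_natural hE.
by exists (RGHom h_nat).
Qed.

Section Yoneda.
Variables (x : C) (M : RG_module R C) (m : M x).

Program Definition yoneda : RG_hom (RG_mor R x) M :=
  @RGHom R C (RG_mor R x) M
    (fun y => freemod_ext (fun f : hom y x => mod_map M f m)) _.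
Next Obligation.
move=> y z f; apply: (@freemod_ind _ _ _
  (freemod_ext (fun f : hom y x => mod_map M f m) \o mod_map (RG_mor R x) f)
  (mod_map M f \o freemod_ext (fun f : hom z x => mod_map M f m))) => h /=.
by rewrite !freemod_ext_single mod_map_comp.
Qed.

Lemma yonedaE y (f : hom y x) : yoneda y (single R f) = mod_map M f m.
Proof. by rewrite /yoneda /= freemod_ext_single. Qed.
End Yoneda.

(** By the Yoneda lemma, a homomorphism out of [RG_mor R x] is an element of the
    value at [x], and elements lift along surjections. *)
Lemma RG_free_lift (s : seq C) M N (p : RG_hom M N) (h : RG_hom (RG_free R s) N) :
  (forall y n, exists m, p y m = n) ->
  exists h' : RG_hom (RG_free R s) M, forall y l, p y (h' y l) = h y l.
Proof.
move=> pS; elim: s h => [|x s IHs] h.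
  exists (RG_hom0 _ _) => y l.
  by rewrite (_ : l = 0) ?linear0 //; exact: thinmx0.
have [h2 h2E] := IHs (RG_comp h (RG_inr (RG_mor R x) (RG_free R s))).
have [m mE] := pS x (h x (single R (idm x), 0)).
pose h1 := yoneda m.
have h1E y l : p y (h1 y l) = h y (l, 0).
  apply: (@freemod_ind _ _ _ (p y \o h1 y)
    (RG_comp h (RG_inl (RG_mor R x) (RG_free R s)) y)) => f.
  rewrite /= yonedaE hom_natural mE -hom_natural /= /pair_map /= linear0.
  by rewrite freemod_ext_single comp_idl.
exists (RG_sub (RG_comp h1 (RG_fst _ _))
   (RG_sub (RG_hom0 _ _) (RG_comp h2 (RG_snd _ _)))) => y [l1 l2] /=.
rewrite sub0r opprK linearD h1E h2E -linearD; congr (h y _).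
by congr pair; rewrite /= ?addr0 ?add0r.
Qed.

Lemma RG_free_cat (s t : seq C) :
  exists (f : RG_hom (RG_sum (RG_free R s) (RG_free R t)) (RG_free R (s ++ t)))
         (g : RG_hom (RG_free R (s ++ t)) (RG_sum (RG_free R s) (RG_free R t))),
    forall y, cancel (f y) (g y) /\ cancel (g y) (f y).
Proof.
elim: s => [|x s [f [g fg]]] /=.
  exists (RG_snd _ _), (RG_inr _ _) => y; split=> [[l1 l2]|l //] /=.
  by congr pair; symmetry; exact: thinmx0.
exists (RG_pair (RG_comp (RG_fst _ _) (RG_fst _ _))
   (RG_comp f (RG_pair (RG_comp (RG_snd _ _) (RG_fst _ _)) (RG_snd _ _)))).
exists (RG_pair (RG_pair (RG_fst _ _) (RG_comp (RG_fst _ _) (RG_comp g (RG_snd _ _))))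
   (RG_comp (RG_snd _ _) (RG_comp g (RG_snd _ _)))) => y.
have [fK gK] := fg y; rewrite /= /RG_pair_at /=.
split=> [[[a b] c]|[a b]] /=; rewrite /RG_pair_at /=.
  by rewrite fK.
by rewrite -surjective_pairing gK.
Qed.

Program Definition RG_abelian : abelian (RG_mod R C) :=
  @Abelian (RG_mod R C) RG_id RG_comp RG_sub RG_hom0 RG_inl RG_inr RG_fst RG_snd
    _ _ _ _ _ _ _ _ _ _ _ _ _ _ _.
Next Obligation. by move=> M N f y a b; exact: (raddfB (hom_at f y)). Qed.
Next Obligation. by []. Qed.
Next Obligation. by []. Qed.
Next Obligation. by []. Qed.
Next Obligation. by []. Qed.
Next Obligation. by []. Qed.
Next Obligation. by []. Qed.
Next Obligation. by []. Qed.
Next Obligation. by []. Qed.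
Next Obligation.
by move=> M N i [m n]; congr pair; rewrite /= ?addr0 ?add0r.
Qed.
Next Obligation.
move=> M N f; exists (RG_ker f), (RG_ker_incl f).
by split=> y; [exact: val_inj | exact: linker_exact].
Qed.
Next Obligation. by move=> K L M k g; exact: RG_factor. Qed.
Next Obligation. by move=> s M N p h; exact: RG_free_lift. Qed.
Next Obligation. by move=> s t; exists (s ++ t); exact: RG_free_cat. Qed.
Next Obligation. by exists [::] => y v; exact: thinmx0. Qed.
End RGModules.

(** * Restriction preserves finitely generated projective modules *)
Section RestrictionFunctor.
Variables (R : comPzRingType) (C : category) (x : C).
Local Notation Rx := (group_ring R (aut x)).

Section Hom.
Variables (M N : RG_module R C) (f : RG_hom M N).

Definition Res_hom_fun (m : Res x M) : Res x N := f x m.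

Lemma Res_hom_linear : linear Res_hom_fun.
Proof.
move=> a m n; rewrite /Res_hom_fun linearD; congr (_ + _).
apply: (@freemod_ind _ _ _ (f x \o @res_actr R C M x m) (@res_actr R C N x (f x m))) a.
by move=> g; rewrite /= /res_actr !res_act_single hom_natural.
Qed.
HB.instance Definition _ := GRing.isLinear.Build Rx^c (Res x M) (Res x N) *:%R
  Res_hom_fun Res_hom_linear.

Definition Res_hom : mod_hom (m := right_mod Rx) (Res x M) (Res x N) :=
  (Res_hom_fun : {linear Res x M -> Res x N}).
End Hom.

Lemma Res_iso M N : mod_iso (A := RG_mod R C) M N ->
  mod_iso (A := right_mod Rx) (Res x M) (Res x N).
Proof.
move=> [f [g fg]]; exists (Res_hom f), (Res_hom g) => i.
by have [fK gK] := fg x; split=> m; [exact: fK | exact: gK].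
Qed.

Lemma Res_short_exact L M N : short_exact (A := RG_mod R C) L M N ->
  short_exact (A := right_mod Rx) (Res x L) (Res x M) (Res x N).
Proof.
move=> [f [g [fI fg gS]]]; exists (Res_hom f), (Res_hom g).
by split=> i; [exact: (fI x) | exact: (fg x) | exact: (gS x)].
Qed.
End RestrictionFunctor.

Section GroupRingModules.
Variables (R : comPzRingType) (G : groupType).
Local Notation RG := (group_ring R G).

Lemma gr_mul_singler (a : RG) (u t : G) :
  gr_mul a (single R u) t = a (t * u^-1)%g.
Proof.
have ev_lin v : linear (fun b : RG => (b v : R^o)) by move=> c f g.
pose ev v : {linear RG -> R^o} :=
  HB.pack (fun b : RG => (b v : R^o)) (GRing.isLinear.Build _ _ _ _ _ (ev_lin v)).
apply: (@freemod_ind _ _ _ (ev t \o gr_mulr (single R u)) (ev (t * u^-1)%g)) => g /=.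
rewrite /gr_mulr gr_mul_single !singleE.
by congr (if _ then _ else _); apply/asbool_equiv_eq; split=> [->|<-];
  rewrite ?mulgK ?mulgVK.
Qed.
End GroupRingModules.

Section MorphismModule.
Variables (R : comPzRingType) (C : category) (y z : C).
Local Notation Ry := (group_ring R (aut y)).

Lemma res_act_mor (h : hom y z) (g : aut y) :
  res_act (M := RG_mor R z) (single R g) (single R h) = single R (h <o> g).
Proof. by rewrite res_act_single /= freemod_ext_single. Qed.

Section Average.
Variables (f : hom y z) (f_fin : finite_set (isotropy f)) (r : R).

Lemma solutions_finite (h : hom y z) :
  finite_set [set g : aut y | f <o> g = h].
Proof.
have [[g0 <-]|no] := pselect (exists g0 : aut y, f <o> g0 = h); last first.
  by apply: (sub_finite_set _ (@finite_set0 _)) => g /= fg; apply: no; exists g.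
apply: (sub_finite_set _ (finite_image (fun g => (g * g0)%g) f_fin)) => g /= fg.
exists (g * g0^-1)%g; last by rewrite mulgVK.
suff : f <o> (g <o> aut_inv g0) = f by [].
by rewrite compA fg -compA aut_invr comp_idr.
Qed.

(** [average1 h] is [r] times the sum of all automorphisms [g] with [f <o> g = h].
    When [r] is the inverse of the order of the isotropy group of [f], this is the
    average of the preimages of [h] under [g |-> f <o> g]. *)
Definition average_fun (h : hom y z) : aut y -> R^o :=
  fun t => if `[< f <o> t = h >] then r else 0.

Lemma average_finsupp h : average_fun h \in @finsupp R (aut y).
Proof.
apply/asboolP; apply: sub_finite_set (solutions_finite h) => t /=.
by rewrite /average_fun; case: asboolP.
Qed.

Definition average1 (h : hom y z) : Ry := FreeMod (average_finsupp h).

Definition average (l : Res y (RG_mor R z)) : Ry^c := freemod_ext average1 l.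

Lemma average1_mul h (u : aut y) :
  average1 (h <o> u) = gr_mul (average1 h) (single R u).
Proof.
apply: val_inj; apply/funext => t.
rewrite -[RHS]/(gr_mul (average1 h) (single R u) t) gr_mul_singler.
congr (if _ then _ else _); apply/asbool_equiv_eq.
rewrite -[(t * u^-1)%g]/(aut_mul t (aut_opp u)) /= compA.
split=> [->|<-].
  by rewrite -compA aut_invr comp_idr.
by rewrite -compA aut_invl comp_idr.
Qed.

Lemma average_linear : linear (average : Res y (RG_mor R z) -> Ry^c^o).
Proof.
move=> a l l'; rewrite /average linearD; congr (_ + _).
pose Av : {linear RG_mor R z y -> Ry} := freemod_ext average1.
pose act b : {linear RG_mor R z y -> RG_mor R z y} := @res_act R C (RG_mor R z) y b.
pose actr m : {linear Ry -> RG_mor R z y} := @res_actr R C (RG_mor R z) y m.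
suff E : Av \o actr l =1 gr_mul (Av l) by exact: E.
apply: freemod_ind => u; rewrite /actr /= /res_actr.
apply: (@freemod_ind _ _ _ (Av \o act (single R u)) (gr_mulr (single R u) \o Av)) => h.
rewrite /Av /act /= /gr_mulr.
by rewrite res_act_mor !freemod_ext_single average1_mul.
Qed.

Definition average_hom : {linear Res y (RG_mor R z) -> Ry^c^o} :=
  HB.pack_for {linear Res y (RG_mor R z) -> Ry^c^o}
    (average : Res y (RG_mor R z) -> Ry^c^o)
    (GRing.isLinear.Build _ _ _ _ _ average_linear).

Lemma average_act0 h : (forall g : aut y, f <o> g <> h) ->
  res_act (M := RG_mor R z) (average1 h) (single R f) = 0.
Proof.
move=> no; rewrite (_ : average1 h = 0).
  exact: (linear0 (@res_actr R C (RG_mor R z) y (single R f))).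
apply: val_inj; apply/funext => t; rewrite /= /average_fun.
by case: asboolP => // /no.
Qed.

(** The solutions [g] of [f <o> g = f <o> g0] form the coset of [g0] under the
    isotropy group of [f], and each contributes [r] times [f <o> g0]. *)
Lemma average_act (g0 : aut y) :
  res_act (M := RG_mor R z) (average1 (f <o> g0)) (single R f) =
  ((#|` fset_set (isotropy f)|)%:R * r) *: single R (f <o> g0).
Proof.
pose tr (g : aut y) : {classic (aut y)} := (g * g0)%g.
have trI : injective tr by exact: mulIg.
pose S := [fset tr g | g in fset_set (isotropy f)]%fset.
have cardS : #|` S| = #|` fset_set (isotropy f)| by rewrite card_imfset.
have SP t : t \in S -> f <o> (t : aut y) = f <o> g0.
  move=> /imfsetP[g /=]; rewrite in_fset_set // inE => /= fg ->.
  by rewrite /tr -[LHS]/(f <o> (g <o> g0)) compA fg.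
rewrite /res_act (@freemod_extE _ _ _ _ _ S).
  rewrite -cardS (@eq_big_seq _ _ _ _ _ _ (fun=> r *: single R (f <o> g0))).
    by rewrite big_const_seq count_predT iter_addr_0 mulr_natl -scalerMnl.
  move=> t /SP ft; rewrite /= freemod_ext_single ft; congr (_ *: _).
  rewrite -[LHS]/(average_fun (f <o> g0) t) /average_fun ft.
  by case: asboolP.
apply/fsubsetP => t; rewrite in_fsupport => /asboolP.
rewrite -[freemod_coef _ t]/(average_fun (f <o> g0) t) /average_fun.
case: asboolP => // ft _; apply/imfsetP; exists (t * g0^-1)%g => /=; last first.
  by rewrite /tr mulgVK.
rewrite in_fset_set // inE /=.
suff : f <o> (t <o> aut_inv g0) = f by [].
by rewrite compA ft -compA aut_invr comp_idr.
Qed.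
End Average.
End MorphismModule.

Section ScalarRow.
Variables (A : pzRingType) (V : lmodType A^c) (phi : {linear V -> A^c^o}).

Definition scalar_row (v : V) : 'rV[A^c]_1 := const_mx (phi v).

Lemma scalar_row_linear : linear scalar_row.
Proof. by move=> a u v; apply/rowP => j; rewrite !mxE linearP. Qed.
HB.instance Definition _ := GRing.isLinear.Build A^c V 'rV[A^c]_1 *:%R
  scalar_row scalar_row_linear.

Lemma row_ext_scalar_row (v w : V) : row_ext (fun=> w) (scalar_row v) = phi v *: w.
Proof. by rewrite /row_ext big_ord1 mxE. Qed.
End ScalarRow.

Section RestrictionOfProjectives.
Variables (R : comPzRingType) (C : category) (y : C).
Local Notation Ry := (group_ring R (aut y)).
Local Notation ops := (right_mod_abelian Ry).

Lemma orbit_refl (z : C) (f : hom y z) : orbit f f.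
Proof. by exists (1%g : aut y) => //; exact: comp_idr. Qed.

Lemma orbit_eq (z : C) (f h : hom y z) (g : aut y) : f <o> g = h -> orbit f = orbit h.
Proof.
move=> <-; apply/seteqP; split=> _ [u _ <-].
  exists (g^-1 * u)%g => //.
  rewrite -[LHS]/(f <o> g <o> (aut_inv g <o> u)) -compA (compA (aut_hom g)).
  by rewrite aut_invr comp_idl.
by exists (g * u)%g => //; rewrite -[LHS]/(f <o> (g <o> u)) compA.
Qed.

(** Choose a representative [f k] in each orbit.  Averaging over the preimages under
    [g |-> f k <o> g] gives the coordinates, and [f k] the vectors, of a dual
    basis: a morphism has only one nonzero coordinate, that of its orbit. *)
Lemma fg_projective_Res_mor (z : C) :
  (forall f : hom y z, finite_set (isotropy f)) ->
  finite_set (range (@orbit C y z)) ->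
  (forall f : hom y z, exists r : R, (#|` fset_set (isotropy f)|)%:R * r = 1) ->
  fg_projective (A := right_mod Ry) (Res y (RG_mor R z)).
Proof.
move=> iso_fin orb_fin card_inv.
have [[f0]|no_hom] := pselect (inhabited (hom y z)); last first.
  apply: (fg_projective_zero ops) => i l; apply: val_inj; apply/funext => f.
  by case: no_hom.
pose T := {classic (set (hom y z))}.
pose O : seq T := fset_set ([set X | range (@orbit C y z) X] : set T).
pose rep (X : T) : hom y z :=
  if pselect (exists f, orbit f = X) is left e then sval (cid e) else f0.
have repP X : X \in O -> orbit (rep X) = X.
  rewrite in_fset_set // inE /= => -[f _ fX]; rewrite /rep.
  by case: pselect => [e|[]]; [exact: svalP (cid e) | exists f].
have OP f : (orbit f : T) \in O by rewrite in_fset_set // inE /=; exists f.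
have O_uniq : uniq O by exact: fset_uniq.
pose f k := rep (nth (orbit f0) O k).
pose r k := sval (cid (card_inv (f k))).
have rE k : (#|` fset_set (isotropy (f k))|)%:R * r k = 1.
  exact: svalP (cid (card_inv (f k))).
pose e k : Res y (RG_mor R z) := single R (f k).
pose M : right_mod Ry := Res y (RG_mor R z).
pose L : right_mod Ry := mod_free (m := right_mod Ry) 1%N.
pose s k : mod_hom M L :=
  (scalar_row (average_hom (iso_fin (f k)) (r k)) :
     {linear Res y (RG_mor R z) -> 'rV[Ry^c]_1}).
pose p k : mod_hom L M :=
  (row_ext (fun=> e k) : {linear 'rV[Ry^c]_1 -> Res y (RG_mor R z)}).
apply: (@fg_projective_dual_basis _ ops M (size O) (fun=> L)
  (fun k => s k) (fun k => p k)).
  by move=> _; exact: (fg_projective_free ops 1%N).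
move=> i l; rewrite /s /p /=.
under eq_bigr do rewrite row_ext_scalar_row.
pose D k : {linear RG_mor R z y -> RG_mor R z y} :=
  (@res_actr R C (RG_mor R z) y (e k) : {linear Ry -> RG_mor R z y}) \o
  (freemod_ext (average1 (iso_fin (f k)) (r k)) : {linear RG_mor R z y -> Ry}).
rewrite -[LHS]/(\sum_(k < size O) D k l).
have D_linear : linear (fun l => \sum_(k < size O) D k l).
  move=> a u v; rewrite scaler_sumr -big_split /=; apply: eq_bigr => k _.
  exact: (linearP (D k)).
pose D' : {linear RG_mor R z y -> RG_mor R z y} :=
  HB.pack (fun l => \sum_(k < size O) D k l)
    (GRing.isLinear.Build _ _ _ _ _ D_linear).
apply: (@freemod_ind _ _ _ D' idfun) => h; rewrite /D' /D /=.
under eq_bigr do rewrite freemod_ext_single /res_actr.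
have kO : (index (orbit h : T) O < size O)%N by rewrite index_mem.
pose k0 := Ordinal kO.
have fk (k : 'I_(size O)) : orbit (f (nat_of_ord k)) = nth (orbit f0 : T) O k.
  by apply/repP/mem_nth/ltn_ord.
rewrite (bigD1 k0) //= big1 ?addr0 => [|k k_k0]; last first.
  apply: average_act0 => g /orbit_eq; rewrite fk => fkh.
  move/eqP: k_k0; apply; apply: val_inj => /=.
  by rewrite -fkh index_uniq.
have [g _ fg] : orbit (f (nat_of_ord k0)) h.
  by rewrite fk /= nth_index //; exact: orbit_refl.
by have := average_act (iso_fin (f k0)) (r k0) g; rewrite fg rE scale1r.
Qed.

Hypotheses (iso_fin : forall (z : C) (f : hom y z), finite_set (isotropy f))
  (orb_fin : forall z : C, finite_set (range (@orbit C y z)))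
  (card_inv : forall (z : C) (f : hom y z),
     exists r : R, (#|` fset_set (isotropy f)|)%:R * r = 1).

(** Restriction is additive, so only the [R mor(?, z)] matter. *)
Lemma fg_projective_Res (P : RG_module R C) :
  fg_projective (A := RG_mod R C) P ->
  fg_projective (A := right_mod Ry) (Res y P).
Proof.
move=> /(fg_projP (RG_abelian R C))[s [t [p pt]]].
apply: (@fg_projective_retract _ ops _ _ (Res_hom y t) (Res_hom y p)); last first.
  by move=> i m; exact: pt.
elim: {t p pt} s => [|x s IHs].
  by apply: (fg_projective_zero ops) => i l; exact: thinmx0.
apply: (@fg_projective_split _ ops _ _ _
  (Res_hom y (RG_inl (RG_mor R x) (RG_free R s)))
  (Res_hom y (RG_fst (RG_mor R x) (RG_free R s)))
  (Res_hom y (RG_inr (RG_mor R x) (RG_free R s)))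
  (Res_hom y (RG_snd (RG_mor R x) (RG_free R s))) _ IHs).
  exact: fg_projective_Res_mor.
by move=> i m; exact: (msum_eta (RG_abelian R C) (M := RG_mor R x) (N := RG_free R s)).
Qed.
End RestrictionOfProjectives.

(** * Extension along the automorphism group of an object *)
Section TensorLift.
Variables (R A : pzRingType) (N : lmodType A^c) (L W : lmodType R).
Variables (act : A -> L -> L) (b : N -> {linear L -> W}).
Hypotheses (bD : forall n n' l, b (n + n') l = b n l + b n' l)
           (b_act : forall (a : A) n l, b ((a : A^c) *: n) l = b n (act a l)).

Lemma tensor_lift_rel v : tensor_rel act v ->
  freemod_ext (fun p : N * L => b p.1 p.2) v = 0.
Proof.
case=> [n n' l|n l l'|n a l|r n l];
  rewrite linearB ?linearD ?linearZZ /= !freemod_ext_single /=.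
- by rewrite -opprD bD subrr.
- by rewrite -opprD linearD subrr.
- by rewrite b_act subrr.
- by rewrite linearZZ scalerN subrr.
Qed.

Definition tensor_lift : {linear tensor N act -> W} := quot_lift tensor_lift_rel.

Lemma tensor_liftE n l : tensor_lift (tens act n l) = b n l.
Proof. by rewrite [LHS](quot_lift_pi tensor_lift_rel) /= freemod_ext_single. Qed.
End TensorLift.

Section TensorFunctor.
Variables (R A : pzRingType) (L : lmodType R) (act : A -> L -> L).

Lemma tens_linear (N : lmodType A^c) n : linear (tens act n : L -> tensor N act).
Proof. by move=> a l l'; rewrite tensDr tensZ. Qed.
HB.instance Definition _ (N : lmodType A^c) n :=
  GRing.isLinear.Build R L (tensor N act) *:%R (tens act n) (@tens_linear N n).

Variables (N N' : lmodType A^c) (f : {linear N -> N'}).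

Lemma tensor_mapl_D n n' l :
  tens act (f (n + n')) l = tens act (f n) l + tens act (f n') l.
Proof. by rewrite linearD tensDl. Qed.

Lemma tensor_mapl_act (a : A) n l :
  tens act (f ((a : A^c) *: n)) l = tens act (f n) (act a l).
Proof. by rewrite linearZZ tens_act. Qed.

Definition tensor_mapl : {linear tensor N act -> tensor N' act} :=
  tensor_lift (b := fun n => tens act (f n)) tensor_mapl_D tensor_mapl_act.

Lemma tensor_maplE n l : tensor_mapl (tens act n l) = tens act (f n) l.
Proof. exact: tensor_liftE. Qed.
End TensorFunctor.

Section MorAction.
Variables (R : comPzRingType) (C : category) (x : C).
Local Notation Rx := (group_ring R (aut x)).

Lemma mor_act_linear y (a : Rx) : linear (@mor_act R C x y a).
Proof.
move=> r l l'; rewrite /mor_act -freemod_ext_fun_linear.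
by apply: eq_freemod_ext => g; rewrite linearP.
Qed.
HB.instance Definition _ y (a : Rx) := GRing.isLinear.Build R (RG_mor R x y)
  (RG_mor R x y) *:%R (@mor_act R C x y a) (@mor_act_linear y a).

Definition mor_actr y (l : RG_mor R x y) (a : Rx) := mor_act a l.

Lemma mor_actr_linear y (l : RG_mor R x y) : linear (mor_actr l).
Proof. by move=> r a b; rewrite /mor_actr /mor_act linearP. Qed.
HB.instance Definition _ y (l : RG_mor R x y) :=
  GRing.isLinear.Build R Rx (RG_mor R x y) *:%R (mor_actr l) (mor_actr_linear l).

Lemma mor_act_single y (g : aut x) (h : hom y x) :
  mor_act (single R g) (single R h : RG_mor R x y) = single R (g <o> h).
Proof. by rewrite /mor_act !freemod_ext_single. Qed.

Lemma mor_actA y (a b : Rx) (l : RG_mor R x y) :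
  mor_act (gr_mul a b) l = mor_act a (mor_act b l).
Proof.
apply: (@freemod_ind _ _ _ (mor_act (gr_mul a b)) (mor_act a \o mor_act b)) l => h /=.
apply: (@freemod_ind _ _ _ (mor_actr (single R h) \o gr_mul a)
  (mor_act a \o mor_actr (single R h))) b => g /=.
apply: (@freemod_ind _ _ _ (mor_actr (single R h) \o gr_mulr (single R g))
  (mor_actr (mor_actr (single R h) (single R g)))) a => u /=.
by rewrite /gr_mulr /mor_actr gr_mul_single !mor_act_single /= -compA.
Qed.

Lemma mor_act1 y (l : RG_mor R x y) : mor_act (1 : Rx) l = l.
Proof.
apply: (@freemod_ind _ _ _ (mor_act (1 : Rx)) idfun) => h.
by rewrite [LHS]mor_act_single comp_idl.
Qed.

(** The induced module [N (x) R mor(?, x)], left adjoint to restriction to [x]. *)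
Program Definition Ext (N : lmodType Rx^c) : RG_module R C :=
  @RGModule R C (mor_tensor N) (mor_tensor_map N) _ _.
Next Obligation. by move=> N y t; exact: mor_tensor_map_id. Qed.
Next Obligation. by move=> N y z w g f t; exact: mor_tensor_map_comp. Qed.

Section DualBasis.
Variables (N : lmodType Rx^c) (s : {linear N -> Rx^c^o}) (q : N).

Lemma Ext_coord_D y n n' (l : RG_mor R x y) :
  mor_act (s (n + n') : Rx) l = mor_act (s n : Rx) l + mor_act (s n' : Rx) l.
Proof. by rewrite linearD; exact: (linearD (mor_actr l)). Qed.

Lemma Ext_coord_act y (a : Rx) n (l : RG_mor R x y) :
  mor_act (s ((a : Rx^c) *: n) : Rx) l = mor_act (s n : Rx) (mor_act a l).
Proof. by rewrite linearZZ -mor_actA. Qed.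

Definition Ext_coord_at y : {linear mor_tensor N y -> RG_mor R x y} :=
  tensor_lift (b := fun n => mor_act (s n : Rx)) (@Ext_coord_D y) (@Ext_coord_act y).

Lemma Ext_coordE y n (l : RG_mor R x y) :
  Ext_coord_at y (tens (@mor_act R C x y) n l) = mor_act (s n : Rx) l.
Proof. exact: tensor_liftE. Qed.

Program Definition Ext_coord : RG_hom (Ext N) (RG_mor R x) :=
  @RGHom R C (Ext N) (RG_mor R x) Ext_coord_at _.
Next Obligation.
move=> y z f; apply: (@tensor_ind _ _ _ _ _ _
  (Ext_coord_at y \o mor_tensor_map N f)
  (mod_map (RG_mor R x) f \o Ext_coord_at z)) => n l.
rewrite [LHS](congr1 (Ext_coord_at y) (tensor_mapE _ n l)) Ext_coordE -mor_act_map.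
exact: (congr1 (mod_map (RG_mor R x) f) (esym (Ext_coordE n l))).
Qed.

Program Definition Ext_vector : RG_hom (RG_mor R x) (Ext N) :=
  @RGHom R C (RG_mor R x) (Ext N) (fun y => tens (@mor_act R C x y) q) _.
Next Obligation. by move=> y z f l; symmetry; exact: tensor_mapE. Qed.
End DualBasis.

(** A dual basis of [Q] induces one of [Ext Q]: the coordinates [c k] give maps to
    [R mor(?, x)] and the basis vectors [b k] give maps back, because
    [q (x) l = \sum_k b k (x) c k q l]. *)
Lemma fg_projective_Ext (Q : lmodType Rx^c) :
  fg_projective (A := right_mod Rx) Q -> fg_projective (A := RG_mod R C) (Ext Q).
Proof.
move=> /(fg_projP (right_mod_abelian Rx))[n [s [p ps]]].
pose s' : {linear Q -> 'rV[Rx^c]_n} := s.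
pose p' : {linear 'rV[Rx^c]_n -> Q} := p.
have c_linear k : linear (fun q : Q => (s' q 0 k : Rx^c^o)).
  by move=> a u v; rewrite linearP !mxE.
pose c k : {linear Q -> Rx^c^o} :=
  HB.pack (fun q : Q => (s' q 0 k : Rx^c^o))
    (GRing.isLinear.Build _ _ _ _ _ (c_linear k)).
pose b k : Q := p' (delta_mx 0 k).
apply: (@fg_projective_dual_basis _ (RG_abelian R C) (Ext Q) n (fun=> RG_mor R x)
  (fun k => Ext_coord (c k)) (fun k => Ext_vector (b k))).
  move=> _.
  apply: (@fg_projective_retract _ (RG_abelian R C) _ (RG_free R [:: x])
    (RG_inl _ _) (RG_fst _ _)) => //.
  exact: (fg_projective_free (RG_abelian R C) [:: x]).
move=> y t.
have D_linear : linear (fun t : mor_tensor Q y =>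
    \sum_(k < n) tens (@mor_act R C x y) (b k) (Ext_coord_at (c k) y t)).
  move=> r u v; rewrite scaler_sumr -big_split /=; apply: eq_bigr => k _.
  pose T : {linear mor_tensor Q y -> mor_tensor Q y} :=
    (tens (@mor_act R C x y) (b k) : {linear RG_mor R x y -> mor_tensor Q y})
      \o Ext_coord_at (c k) y.
  exact: (linearP T).
pose D : {linear mor_tensor Q y -> mor_tensor Q y} :=
  HB.pack (fun t : mor_tensor Q y =>
    \sum_(k < n) tens (@mor_act R C x y) (b k) (Ext_coord_at (c k) y t))
    (GRing.isLinear.Build _ _ _ _ _ D_linear).
apply: (@tensor_ind _ _ _ _ _ _ D idfun) => q l.
transitivity (\sum_(k < n) tens (@mor_act R C x y) ((c k q : Rx^c) *: b k) l).
  by apply: eq_bigr => k _; rewrite Ext_coordE tens_act.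
rewrite -[RHS]/(tens (@mor_act R C x y) q l).
rewrite -{2}(ps tt q) -[mod_app p _]/(p' (s' q)) (row_sum_delta (s' q)) linear_sum.
have tens_sum (f : 'I_n -> Q) : tens (@mor_act R C x y) (\sum_k f k) l =
    \sum_k tens (@mor_act R C x y) (f k) l.
  elim/big_rec2: _ => [|k u v _ <-]; last by rewrite tensDl.
  by apply: (@addrI _ (tens (@mor_act R C x y) 0 l)); rewrite -tensDl !addr0.
by rewrite tens_sum; apply: eq_bigr => k _; rewrite linearZZ.
Qed.
End MorAction.

Section ExtensionFunctor.
Variables (R : comPzRingType) (C : category) (x : C).
Local Notation Rx := (group_ring R (aut x)).

Section Map.
Variables (N N' : lmodType Rx^c) (f : {linear N -> N'}).

Definition Ext_map_at y : {linear mor_tensor N y -> mor_tensor N' y} :=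
  tensor_mapl (@mor_act R C x y) f.

Lemma Ext_mapE y n (l : RG_mor R x y) :
  Ext_map_at y (tens (@mor_act R C x y) n l) = tens (@mor_act R C x y) (f n) l.
Proof. exact: tensor_maplE. Qed.

Program Definition Ext_map : RG_hom (Ext N) (Ext N') :=
  @RGHom R C (Ext N) (Ext N') Ext_map_at _.
Next Obligation.
move=> y z h; apply: (@tensor_ind _ _ _ _ _ _
  (Ext_map_at y \o mor_tensor_map N h) (mor_tensor_map N' h \o Ext_map_at z)) => n l.
rewrite [LHS](congr1 (Ext_map_at y) (tensor_mapE _ n l)) Ext_mapE.
rewrite [RHS](congr1 (mor_tensor_map N' h) (Ext_mapE n l)).
by symmetry; exact: tensor_mapE.
Qed.
End Map.

Section Counit.
Variable M : RG_module R C.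

Lemma counit_D y (m m' : Res x M) (l : RG_mor R x y) :
  yoneda (m + m' : M x) y l = yoneda (m : M x) y l + yoneda (m' : M x) y l.
Proof.
rewrite -[yoneda (m : M x) y l]scale1r -[RHS]freemod_ext_fun_linear.
by apply: eq_freemod_ext => f; rewrite scale1r linearD.
Qed.

Lemma counit_act y (a : Rx) (m : Res x M) (l : RG_mor R x y) :
  yoneda ((a : Rx^c) *: m : Res x M) y l = yoneda (m : M x) y (mor_act a l).
Proof.
apply: (@freemod_ind _ _ _ (yoneda ((a : Rx^c) *: m : Res x M) y)
  (yoneda (m : M x) y \o mor_act a)) l => h.
rewrite yonedaE.
apply: (@freemod_ind _ _ _ (mod_map M h \o @res_actr R C M x m)
  (yoneda (m : M x) y \o mor_actr (single R h))) a => g /=.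
rewrite /res_actr res_act_single /mor_actr mor_act_single.
by rewrite freemod_ext_single mod_map_comp.
Qed.

Definition counit_at y : {linear mor_tensor (Res x M) y -> M y} :=
  tensor_lift
    (b := fun m : Res x M =>
            (yoneda (m : M x) y : {linear RG_mor R x y -> M y}))
    (@counit_D y) (@counit_act y).

Lemma counitE y (m : Res x M) (l : RG_mor R x y) :
  counit_at y (tens (@mor_act R C x y) m l) = yoneda (m : M x) y l.
Proof. exact: tensor_liftE. Qed.

Program Definition counit : RG_hom (Ext (Res x M)) M :=
  @RGHom R C (Ext (Res x M)) M counit_at _.
Next Obligation.
move=> y z h; apply: (@tensor_ind _ _ _ _ _ _
  (counit_at y \o mor_tensor_map (Res x M) h) (mod_map M h \o counit_at z)) => m l.
rewrite [LHS](congr1 (counit_at y) (tensor_mapE _ m l)) counitE.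
by rewrite [RHS](congr1 (mod_map M h) (counitE m l)) hom_natural.
Qed.
End Counit.
End ExtensionFunctor.

(** The map from [mor_tensor Q y] to [Q] below is to be [R]-linear; [base_mod Q]
    is [Q] regarded as an [R]-module. *)
Section ScalarRestriction.
Variables (R : comPzRingType) (G : groupType).
Local Notation RG := (group_ring R G).

Lemma gr_mul_scaler1 (r : R) (a : RG) : gr_mul a (r *: (1 : RG)) = r *: a.
Proof. by rewrite linearZZ; congr (_ *: _); exact: mulr1. Qed.

Variable Q : lmodType RG^c.

Definition base_mod : Type := Q.
HB.instance Definition _ := GRing.Zmodule.on base_mod.

Definition base_scale (r : R) (q : base_mod) : base_mod :=
  ((r *: (1 : RG)) : RG^c) *: (q : Q).

Lemma base_scale_act (r : R) (a : RG) (q : Q) :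
  ((r *: a : RG) : RG^c) *: q = base_scale r ((a : RG^c) *: q).
Proof.
rewrite /base_scale scalerA; congr (_ *: _).
by rewrite -[RHS]/(gr_mul a (r *: (1 : RG))) gr_mul_scaler1.
Qed.

Lemma base_scaleA r s q : base_scale r (base_scale s q) = base_scale (r * s) q.
Proof. by rewrite -base_scale_act scalerA. Qed.
Lemma base_scale1 : left_id 1 base_scale.
Proof. by move=> q; rewrite /base_scale scale1r; exact: (@scale1r RG^c Q). Qed.
Lemma base_scaleDr : right_distributive base_scale +%R.
Proof. by move=> r p q; exact: scalerDr. Qed.
Lemma base_scaleDl q : {morph base_scale^~ q : r s / r + s}.
Proof. by move=> r s; rewrite /base_scale scalerDl; exact: scalerDl. Qed.
HB.instance Definition _ := GRing.Zmodule_isLmodule.Build R base_mod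
  base_scaleA base_scale1 base_scaleDr base_scaleDl.
End ScalarRestriction.

(** At an object [y] isomorphic to [x] by [i], the module [Ext Q] is a copy of [Q]:
    by the EI property every [h : y -> x] is [g <o> i] for an automorphism [g] of
    [x], whence [q (x) h = q g (x) i]. *)
Section ExtensionOnIsoClass.
Variables (R : comPzRingType) (C : EI_category) (x : C).
Local Notation Rx := (group_ring R (aut x)).
Variable Q : lmodType Rx^c.

Lemma EI_aut_ex (f : hom x x) : exists g : aut x, aut_hom g = f.
Proof. by have [g [gf fg]] := EI_axiom f; exists (Aut gf fg). Qed.

Definition EI_aut (f : hom x x) : aut x := sval (cid (EI_aut_ex f)).

Lemma EI_autE f : aut_hom (EI_aut f) = f.
Proof. exact: svalP (cid (EI_aut_ex f)). Qed.

Variables (y : C) (i : hom y x) (i' : hom x y).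
Hypotheses (i'i : i' <o> i = idm y) (ii' : i <o> i' = idm x).

Definition to_aut : {linear RG_mor R x y -> Rx} :=
  freemod_ext (fun h : hom y x => single R (EI_aut (h <o> i'))).

Lemma to_autE (h : hom y x) : to_aut (single R h) = single R (EI_aut (h <o> i')).
Proof. exact: freemod_ext_single. Qed.

Lemma to_aut_act (a : Rx) (l : RG_mor R x y) :
  to_aut (mor_act a l) = gr_mul a (to_aut l).
Proof.
apply: (@freemod_ind _ _ _ (to_aut \o mor_act a) (gr_mul a \o to_aut)) l => h.
apply: (@freemod_ind _ _ _ (to_aut \o mor_actr (single R h))
  (gr_mulr (to_aut (single R h)))) a => g.
rewrite [LHS](congr1 to_aut (mor_act_single R g h)) to_autE.
rewrite -[RHS]/(gr_mul (single R g) (to_aut (single R h))) to_autE gr_mul_single.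
congr (single R _); apply: aut_inj.
by rewrite EI_autE -[RHS]/(g <o> EI_aut _) EI_autE compA.
Qed.

Lemma mor_act_to_aut (l : RG_mor R x y) : mor_act (to_aut l) (single R i) = l.
Proof.
apply: (@freemod_ind _ _ _ (mor_actr (single R i) \o to_aut) idfun) l => h.
rewrite [LHS](congr1 (mor_actr (single R i)) (to_autE h)) [LHS]mor_act_single EI_autE.
by rewrite -compA i'i comp_idr.
Qed.

Lemma contract_linear q : linear (fun l : RG_mor R x y =>
  ((to_aut l : Rx^c) *: q : base_mod Q)).
Proof.
by move=> r l l'; rewrite linearP scalerDl; congr (_ + _); exact: base_scale_act.
Qed.

Definition contract_fun (q : Q) : {linear RG_mor R x y -> base_mod Q} :=
  HB.pack_for {linear RG_mor R x y -> base_mod Q}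
    (fun l : RG_mor R x y => ((to_aut l : Rx^c) *: q : base_mod Q))
    (GRing.isLinear.Build _ _ _ _ _ (contract_linear q)).

Lemma contract_D (q q' : Q) l :
  contract_fun (q + q') l = contract_fun q l + contract_fun q' l.
Proof. exact: (scalerDr (to_aut l : Rx^c) q q'). Qed.

Lemma contract_act (a : Rx) (q : Q) l :
  contract_fun ((a : Rx^c) *: q) l = contract_fun q (mor_act a l).
Proof.
rewrite -[LHS]/((to_aut l : Rx^c) *: ((a : Rx^c) *: q)) scalerA.
by rewrite -[RHS]/((to_aut (mor_act a l) : Rx^c) *: q) to_aut_act.
Qed.

Definition contract : {linear mor_tensor Q y -> base_mod Q} :=
  tensor_lift contract_D contract_act.

Lemma contractE q (l : RG_mor R x y) :
  contract (tens (@mor_act R C x y) q l) = (to_aut l : Rx^c) *: q.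
Proof. exact: tensor_liftE. Qed.

Definition expand (q : Q) : mor_tensor Q y := tens (@mor_act R C x y) q (single R i).

Lemma expandK : cancel expand contract.
Proof.
move=> q; rewrite contractE to_autE ii'.
rewrite (_ : EI_aut (idm x) = 1%g); first exact: (@scale1r Rx^c Q).
by apply: aut_inj; rewrite EI_autE.
Qed.

Lemma expand_linear : linear (expand : base_mod Q -> mor_tensor Q y).
Proof.
move=> r p q; rewrite /expand tensDl; congr (_ + _).
rewrite tens_act -tensZ; congr tens.
apply: etrans (linearZZ (mor_actr (single R i : RG_mor R x y)) r (1 : Rx)) _.
by congr (_ *: _); exact: mor_act1.
Qed.

Lemma contractK : cancel contract expand.
Proof.
pose ex : {linear base_mod Q -> mor_tensor Q y} :=
  HB.pack (expand : base_mod Q -> mor_tensor Q y)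
    (GRing.isLinear.Build _ _ _ _ _ expand_linear).
apply: (@tensor_ind _ _ _ _ _ _ (ex \o contract) idfun) => q l.
rewrite [LHS](congr1 ex (contractE q l)).
by rewrite -[LHS]/(expand _) /expand tens_act mor_act_to_aut.
Qed.
End ExtensionOnIsoClass.

(** * The part of a module on one isomorphism class *)
Section Guard.
Variables (R : pzRingType) (P : Prop) (p : {P} + {~ P}).

Lemma guard_map_comm (Q : Prop) (q : {Q} + {~ Q}) (V V' W W' : lmodType R)
    (F : {linear V -> V'}) (F' : {linear W -> W'})
    (u : {linear V -> W}) (u' : {linear V' -> W'}) :
  (forall v, F' (u v) = u' (F v)) ->
  forall v, guard_map q q F' (guard_map p q u v) =
            guard_map p q u' (guard_map p p F v).
Proof. by move=> E; case: p => hp; case: q => hq v //=; rewrite ?linear0. Qed.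

Lemma guard_map_inj (V W : lmodType R) (F : {linear V -> W}) :
  (P -> injective F) -> injective (guard_map p p F).
Proof.
by case: p => hp /= FI; [exact: FI | move=> u v _; rewrite [u]thinmx0 [v]thinmx0].
Qed.

Lemma guard_map_surj (V W : lmodType R) (F : {linear V -> W}) :
  (P -> forall w, exists v, F v = w) ->
  forall w, exists v, guard_map p p F v = w.
Proof. by case: p => hp /= FS w; [exact: FS | exists 0; rewrite [w]thinmx0]. Qed.

Lemma guard_map_exact (V W U : lmodType R) (F : {linear V -> W})
    (F' : {linear W -> U}) :
  (P -> forall w, F' w = 0 <-> exists v, F v = w) ->
  forall w, guard_map p p F' w = 0 <-> exists v, guard_map p p F v = w.
Proof.
case: p => hp /= E w; first exact: E.
by split=> // _; exists 0; rewrite [w]thinmx0.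
Qed.

Definition guard_in (V : lmodType R) : {linear V -> guard p V} :=
  guard_map (left I : {True} + {~ True}) p (idfun : {linear V -> V}).

Lemma guard_in_inj (V : lmodType R) : P -> injective (@guard_in V).
Proof. by rewrite /guard_in; case: p => // hp _ u v. Qed.

Lemma guard_in_surj (V : lmodType R) : P -> forall w, exists v, @guard_in V v = w.
Proof. by rewrite /guard_in; case: p => // hp _ w; exists w. Qed.

Lemma guard_map_in (V W : lmodType R) (F : {linear V -> W}) v :
  guard_map p p F (guard_in V v) = guard_in W (F v).
Proof. by rewrite /guard_in; case: p. Qed.

Lemma guard_zero (V : lmodType R) : ~ P -> forall v : guard p V, v = 0.
Proof. by case: p => hp nP v; [case: (nP hp) | exact: thinmx0]. Qed.
End Guard.

Lemma isomorphic_refl (C : category) (y : C) : isomorphic y y.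
Proof. by exists (idm y), (idm y); rewrite comp_idl. Qed.

Section Cut.
Variables (R : comPzRingType) (C : EI_category).
Implicit Types (L M N : RG_module R C) (x y z : C).

Local Notation sel y x := (pselect (isomorphic y x)).

(** A functor because, by the EI property, a composite between two objects of the
    class of [x] never leaves that class. *)
Program Definition cut x M : RG_module R C :=
  @RGModule R C (fun y => guard (sel y x) (M y))
    (fun y z f => guard_map (sel z x) (sel y x) (mod_map M f)) _ _.
Next Obligation.
by move=> x M y m; apply: guard_map_id => t; exact: mod_map_id.
Qed.
Next Obligation.
move=> x M y z w g f m; apply: (@guard_map_comp) => [wx yx|t].
  exact: (EI_between f g yx wx).
exact: mod_map_comp.
Qed.

Program Definition cut_map x M N (f : RG_hom M N) : RG_hom (cut x M) (cut x N) :=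
  @RGHom R C (cut x M) (cut x N) (fun y => guard_map (sel y x) (sel y x) (f y)) _.
Next Obligation.
by move=> x M N f y z h m; apply: guard_map_comm => v; exact: hom_natural.
Qed.

Lemma cut_iso x M N (f : RG_hom M N) :
  (forall y, isomorphic y x -> injective (f y)) ->
  (forall y, isomorphic y x -> forall n, exists m, f y m = n) ->
  mod_iso (A := RG_mod R C) (cut x M) (cut x N).
Proof.
move=> fI fS; apply: (@bijective_iso _ (RG_abelian R C) _ _ (cut_map x f)) => y.
  by apply: guard_map_inj => yx; exact: fI.
by apply: guard_map_surj => yx; exact: fS.
Qed.

Lemma cut_exact x L M N (f : RG_hom L M) (g : RG_hom M N) :
  (forall y, isomorphic y x -> injective (f y)) ->
  (forall y, isomorphic y x -> forall m, g y m = 0 <-> exists l, f y l = m) ->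
  (forall y, isomorphic y x -> forall n, exists m, g y m = n) ->
  short_exact (A := RG_mod R C) (cut x L) (cut x M) (cut x N).
Proof.
move=> fI fg gS; exists (cut_map x f), (cut_map x g); split=> y.
- by apply: guard_map_inj => yx; exact: fI.
- by apply: guard_map_exact => yx; exact: fg.
- by apply: guard_map_surj => yx; exact: gS.
Qed.

Section Inclusion.
Variable x : C.
Local Notation Rx := (group_ring R (aut x)).
Implicit Types Q : lmodType Rx^c.

(** Values and structure maps of the two modules are convertible; only the proofs of
    the functor laws differ. *)
Lemma Inc_cut Q : mod_iso (A := RG_mod R C) (Inc Q) (cut x (Ext Q)).
Proof.
have nat1 y z (f : hom y z) (m : Inc Q z) :
  (idfun : {linear Inc Q y -> cut x (Ext Q) y}) (mod_map (Inc Q) f m) =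
  mod_map (cut x (Ext Q)) f ((idfun : {linear Inc Q z -> cut x (Ext Q) z}) m).
  by [].
have nat2 y z (f : hom y z) (m : cut x (Ext Q) z) :
  (idfun : {linear cut x (Ext Q) y -> Inc Q y}) (mod_map (cut x (Ext Q)) f m) =
  mod_map (Inc Q) f ((idfun : {linear cut x (Ext Q) z -> Inc Q z}) m).
  by [].
by exists (RGHom nat1), (RGHom nat2) => y; split.
Qed.

Lemma Ext_map_expand Q Q' (h : {linear Q -> Q'}) y (i : hom y x) q :
  Ext_map h y (expand i q) = expand i (h q).
Proof. exact: Ext_mapE. Qed.

(** On the class of [x], [expand i] identifies the sequence with the given one. *)
Lemma Inc_short_exact Q0 Q1 Q2 : short_exact (A := right_mod Rx) Q0 Q1 Q2 ->
  short_exact (A := RG_mod R C) (Inc Q0) (Inc Q1) (Inc Q2).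
Proof.
move=> [f [g [fI fg gS]]].
pose f' : {linear Q0 -> Q1} := f; pose g' : {linear Q1 -> Q2} := g.
suff : short_exact (A := RG_mod R C) (cut x (Ext Q0)) (cut x (Ext Q1)) (cut x (Ext Q2)).
  move=> /(short_exact_iso (RG_abelian R C)); apply.
  - exact: iso_sym (Inc_cut Q0).
  - exact: iso_sym (Inc_cut Q1).
  - exact: iso_sym (Inc_cut Q2).
apply: (@cut_exact x _ _ _ (Ext_map f') (Ext_map g')) =>
  y [i [i' [i'i ii']]].
- move=> s t; rewrite -[s](contractK i'i) -[t](contractK i'i) !Ext_map_expand.
  by move=> /(can_inj (expandK ii'))/(fI tt) ->.
- move=> t; rewrite -[t](contractK i'i) Ext_map_expand -[0](contractK i'i).
  split=> [/(can_inj (expandK ii'))|].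
    rewrite linear0 => /(fg tt)[q qE]; exists (expand i q).
    by rewrite Ext_map_expand; congr expand.
  move=> [s]; rewrite -[s](contractK i'i) Ext_map_expand => /(can_inj (expandK ii')) <-.
  congr expand; rewrite linear0; apply/(fg tt).
  by eexists.
- move=> t; have [q qE] := gS tt (contract Q2 i' t).
  exists (expand i q); rewrite Ext_map_expand -[t](contractK i'i); congr expand.
  exact: qE.
Qed.

Lemma Inc_iso Q Q' : mod_iso (A := right_mod Rx) Q Q' ->
  mod_iso (A := RG_mod R C) (Inc Q) (Inc Q').
Proof.
move=> [f [g fg]]; have [fK gK] := fg tt.
pose f' : {linear Q -> Q'} := f.
apply: (iso_trans (RG_abelian R C) (Inc_cut Q)).
apply: (iso_trans (RG_abelian R C) _ (iso_sym (Inc_cut Q'))).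
apply: (@cut_iso x _ _ (Ext_map f')) => y [i [i' [i'i ii']]].
  move=> s t; rewrite -[s](contractK i'i) -[t](contractK i'i) !Ext_map_expand.
  by move=> /(can_inj (expandK ii'))/(can_inj fK) ->.
move=> t; exists (expand i (mod_app g (i := tt) (contract Q' i' t))).
by rewrite Ext_map_expand -[RHS](contractK i'i); congr expand; exact: gK.
Qed.

Lemma counit_expand M y (i : hom y x) (m : Res x M) :
  counit x M y (expand i m) = mod_map M i (m : M x).
Proof. by rewrite [LHS]counitE yonedaE. Qed.

(** The counit [m (x) h |-> M(h) m] becomes [M(i)] under [expand i], hence is
    bijective on the class of [x]. *)
Lemma Inc_Res M : mod_iso (A := RG_mod R C) (Inc (Res x M)) (cut x M).
Proof.
apply: (iso_trans (RG_abelian R C) (Inc_cut _)).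
apply: (@cut_iso x _ _ (counit x M)) => y [i [i' [i'i ii']]].
  pose c (s : Ext (Res x M) y) : M x := contract (Res x M) i' s.
  have counitc s : counit x M y s = mod_map M i (c s).
    by rewrite -[s in LHS](contractK i'i); exact: counit_expand.
  move=> s t; rewrite !counitc => E; apply: (can_inj (contractK i'i)).
  suff : c s = c t by [].
  have K m : mod_map M i' (mod_map M i m) = m by rewrite -mod_map_comp ii' mod_map_id.
  by rewrite -[c s]K E K.
move=> m; exists (expand i (mod_map M i' m : Res x M)).
by rewrite counit_expand -mod_map_comp i'i mod_map_id.
Qed.

Lemma Res_Ext Q : mod_iso (A := right_mod Rx) Q (Res x (Ext Q)).
Proof.
pose u (q : Q) : Res x (Ext Q) := expand (idm x) q.
have u_linear : linear u.
  move=> a p q; rewrite /u /expand tensDl; congr (_ + _); rewrite tens_act.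
  pose T : {linear RG_mor R x x -> mor_tensor Q x} := tens (@mor_act R C x x) p.
  (* Both sides are R-linear in a, so it may be taken in the group. *)
  pose F : {linear Rx -> mor_tensor Q x} :=
    T \o (mor_actr (single R (idm x)) : {linear Rx -> RG_mor R x x}).
  pose F' : {linear Rx -> mor_tensor Q x} :=
    HB.pack_for {linear Rx -> mor_tensor Q x}
      (fun b : Rx => res_act b (T (single R (idm x)) : res_carrier (Ext Q) x))
      (GRing.isLinear.Build _ _ _ _ _
         (@res_actr_linear R C (Ext Q) x (T (single R (idm x))))).
  suff E : F =1 F' by exact: E.
  apply: freemod_ind => g; rewrite /F /F'.
  rewrite [LHS](congr1 T (mor_act_single R g (idm x))).
  rewrite [RHS]res_act_single [RHS](tensor_mapE _ p (single R (idm x))).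
  by congr (T _); rewrite /= freemod_ext_single comp_idl comp_idr.
pose U : {linear Q -> Res x (Ext Q)} :=
  HB.pack_for {linear Q -> Res x (Ext Q)} u (GRing.isLinear.Build _ _ _ _ _ u_linear).
have id2 : idm x <o> idm x = idm x by exact: comp_idl.
apply: (@bijective_iso _ (right_mod_abelian Rx) Q (Res x (Ext Q)) U) => i.
  exact: can_inj (expandK id2).
by move=> t; exists (contract Q (idm x) t); exact: (contractK id2).
Qed.

Lemma Res_cut M : mod_iso (A := right_mod Rx) (Res x M) (Res x (cut x M)).
Proof.
pose u (m : Res x M) : Res x (cut x M) :=
  guard_in (sel x x) (M x) m.
have u_linear : linear u.
  move=> a m n; rewrite /u linearD; congr (_ + _).
  (* As above, a reduces to a group element, which acts by a structure map. *)
  pose F : {linear Rx -> guard (sel x x) (M x)} :=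
    (guard_in (sel x x) (M x) : {linear M x -> guard (sel x x) (M x)}) \o
    HB.pack_for {linear Rx -> M x} (fun b : Rx => res_act b (m : M x))
      (GRing.isLinear.Build _ _ _ _ _ (@res_actr_linear R C M x m)).
  pose F' : {linear Rx -> guard (sel x x) (M x)} :=
    HB.pack_for {linear Rx -> guard (sel x x) (M x)}
      (fun b : Rx => res_act b (u m : res_carrier (cut x M) x))
      (GRing.isLinear.Build _ _ _ _ _ (@res_actr_linear R C (cut x M) x (u m))).
  suff E : F =1 F' by exact: E.
  apply: freemod_ind => g; rewrite /F /F' /=.
  by rewrite [RHS]res_act_single res_act_single; symmetry; exact: guard_map_in.
pose U : {linear Res x M -> Res x (cut x M)} :=
  HB.pack_for {linear Res x M -> Res x (cut x M)} u
    (GRing.isLinear.Build _ _ _ _ _ u_linear).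
apply: (@bijective_iso _ (right_mod_abelian Rx) _ _ U) => i.
  exact: guard_in_inj (isomorphic_refl x).
exact: guard_in_surj (isomorphic_refl x).
Qed.

Lemma Res_Inc Q : mod_iso (A := right_mod Rx) Q (Res x (Inc Q)).
Proof.
have H := right_mod_abelian Rx.
apply: (iso_trans H (Res_Ext Q)); apply: (iso_trans H (Res_cut _)).
exact/Res_iso/iso_sym/Inc_cut.
Qed.

Lemma Res_Inc_zero y Q : ~ isomorphic y x ->
  mod_is_zero (A := right_mod (group_ring R (aut y))) (Res y (Inc Q)).
Proof. by move=> yx i m; exact: guard_zero. Qed.
End Inclusion.
End Cut.

(** * Filtration by isomorphism classes *)
Section IsoClasses.
Variable C : category.
Implicit Types (x y z : C) (c d e : iso_class C).

Lemma isomorphic_sym x y : isomorphic x y -> isomorphic y x.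
Proof. by move=> [f [g [gf fg]]]; exists g, f. Qed.

Lemma isomorphic_trans x y z : isomorphic x y -> isomorphic y z -> isomorphic x z.
Proof.
move=> [f [f' [ff ff']]] [g [g' [gg gg']]]; exists (g <o> f), (f' <o> g').
split; first by rewrite compA -(compA f') gg comp_idr ff.
by rewrite compA -(compA g) ff' comp_idr gg'.
Qed.

Lemma iso_clP x y : iso_cl x = iso_cl y <-> isomorphic x y.
Proof.
split=> [/(congr1 sval) /= ->|xy]; first exact: isomorphic_refl.
have E : isomorphic x = isomorphic y.
  apply/funext => z; apply/propext; split; apply: isomorphic_trans => //.
  exact: isomorphic_sym.
rewrite /iso_cl; move: (ex_intro _ x _); rewrite E => h.
by congr exist; exact: Prop_irrelevance.
Qed.

Lemma iso_leP x y : iso_le (iso_cl x) (iso_cl y) <-> inhabited (hom x y).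
Proof.
split=> [[x' [y' [/iso_clP [i [i' _]] /iso_clP[j [j' _]] [f]]]]|xy].
  by exists; exact: (j <o> f <o> i').
by exists x, y.
Qed.

Lemma iso_cl_ex c : exists x, c = iso_cl x.
Proof.
case: c => S h; have [x Sx] := h; exists x; rewrite /iso_cl.
move: h (ex_intro _ x _); rewrite Sx => h h'.
by congr exist; exact: Prop_irrelevance.
Qed.

Lemma iso_le_refl c : iso_le c c.
Proof. by have [x ->] := iso_cl_ex c; apply/iso_leP; exists; exact: idm. Qed.

Lemma iso_le_trans c d e : iso_le c d -> iso_le d e -> iso_le c e.
Proof.
have [x ->] := iso_cl_ex c; have [y ->] := iso_cl_ex d; have [z ->] := iso_cl_ex e.
by move=> /iso_leP[f] /iso_leP[g]; apply/iso_leP; exists; exact: (g <o> f).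
Qed.
End IsoClasses.

Lemma iso_le_anti (C : EI_category) (c d : iso_class C) :
  iso_le c d -> iso_le d c -> c = d.
Proof.
have [x ->] := iso_cl_ex c; have [y ->] := iso_cl_ex d.
move=> /iso_leP[f] /iso_leP[g]; apply/iso_clP.
have xx := isomorphic_refl x.
by apply: isomorphic_sym; exact: (EI_between f g xx xx).
Qed.

Lemma exists_maximal (C : EI_category) (s : seq {classic iso_class C}) : s <> [::] ->
  exists2 c, c \in s & forall d, d \in s -> iso_le c d -> d = c.
Proof.
elim: s => // c s IHs _; have [->|s0] := pselect (s = [::]).
  by exists c => [|d]; rewrite inE // => /eqP.
have [m ms mmax] := IHs s0.
have [mc|mc] := pselect (iso_le m c).
  exists c => [|d]; rewrite !inE ?eqxx // => /predU1P[//|ds cd].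
  have dm := mmax d ds (iso_le_trans mc cd).
  by rewrite dm in cd *; exact: iso_le_anti.
exists m => [|d]; rewrite !inE ?ms ?orbT // => /predU1P[-> //|]; exact: mmax.
Qed.

Section Filtration.
Variables (R : comPzRingType) (G : EI_category) (rep : iso_class G -> G).
Hypothesis repP : forall c, iso_cl (rep c) = c.
Local Notation J := {classic iso_class G}.
Local Notation RGM := (RG_mod R G).
Local Notation ops := (RG_abelian R G).
Implicit Types (M : RG_module R G) (s : seq J) (c d : J).

Definition supported M s := forall y, (iso_cl y : J) \notin s -> forall m : M y, m = 0.

Lemma iso_rep y c : isomorphic y (rep c) <-> iso_cl y = c.
Proof. by rewrite -iso_clP repP. Qed.

Section Peel.
Variables (M : RG_module R G) (s : seq J) (c : J).
Hypotheses (Ms : supported M s) (c_max : forall d, d \in s -> iso_le c d -> d = c).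

(** Natural because no nonzero element lives above [c]: a morphism from the class
    of [c] to another class ends where [M] vanishes. *)
Program Definition to_cut : RG_hom M (cut (rep c) M) :=
  @RGHom R G M (cut (rep c) M)
    (fun y => guard_in (pselect (isomorphic y (rep c))) (M y)) _.
Next Obligation.
move=> y z f m; rewrite /cut /= /guard_in.
case: (pselect (isomorphic y (rep c))) => [yc|yc]; last first.
  by rewrite [LHS]thinmx0 [RHS]thinmx0.
case: (pselect (isomorphic z (rep c))) => [//|zc] /=.
rewrite (Ms _ m) ?linear0 //; apply/negP => zs; apply/zc/iso_rep/c_max => //.
by rewrite -(iso_rep y c).1 //; apply/iso_leP; exists.
Qed.

Lemma to_cut_eq0 y (m : M y) : ~ isomorphic y (rep c) -> to_cut y m = 0.
Proof. by move=> yc; apply: guard_zero. Qed.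

Lemma peel : exists K, [/\ short_exact (A := RGM) K M (cut (rep c) M),
  supported K [seq d <- s | d != c] &
  forall d, d != c -> mod_iso (A := RGM) (cut (rep d) K) (cut (rep d) M)].
Proof.
exists (RG_ker to_cut); split.
- exists (RG_ker_incl to_cut), to_cut; split=> y.
  + exact: val_inj.
  + exact: linker_exact.
  + rewrite /=; move: (pselect _) => p n.
    have [pc|pc] := pselect (isomorphic y (rep c)); first exact: guard_in_surj.
    by exists 0; rewrite (guard_zero pc n) linear0.
- move=> y; rewrite mem_filter negb_and negbK => ys k; apply: val_inj.
  case/orP: ys => [/eqP yc|ys]; last exact: Ms.
  have /guard_in_inj := (iso_rep y c).2 yc; apply.
  by rewrite linear0; exact: (linker_valP k).
- move=> d dc; apply: (@cut_iso _ _ _ _ _ (RG_ker_incl to_cut)) => y yd.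
    exact: val_inj.
  move=> m; apply/linker_exact/to_cut_eq0 => /iso_rep yc.
  by move/eqP: dc; apply; rewrite -yc; symmetry; exact/iso_rep.
Qed.
End Peel.

(** Peel off a maximal class, and induct on the number of classes. *)
Lemma has_class_filtration s (F : J -> K0 RGM) M : uniq s -> supported M s ->
  (forall c, c \in s -> has_class (A := RGM) (cut (rep c) M) (F c)) ->
  has_class (A := RGM) M (ab_lsum s F).
Proof.
have [n] := ubnP (size s); elim: n => // n IHn in s M *.
rewrite ltnS => sn us Ms Fs; have [s0|s0] := pselect (s = [::]).
  rewrite s0 /=; apply: (has_class_zero ops) => y m; apply: Ms.
  by rewrite s0.
have [c cs c_max] := exists_maximal s0.
have [K [KMc Ks Kd]] := peel Ms c_max.
rewrite (ab_lsum_rem F cs) ab_addC; apply: (has_classD ops KMc _ (Fs _ cs)).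
have remE : rem c s = [seq d <- s | d != c] by exact: rem_filter.
apply: IHn; rewrite ?rem_uniq ?remE //.
  by rewrite -remE size_rem //; case: (s) s0 sn => //= d t _; exact.
move=> d; rewrite mem_filter => /andP[dc ds].
exact: (has_class_iso ops (iso_sym (Kd _ dc)) (Fs _ ds)).
Qed.
End Filtration.

(** * Restriction and inclusion on K_0 *)
Section Main.
Variables (R : comPzRingType) (G : EI_category) (rep : iso_class G -> G).
Hypotheses (repP : forall c, iso_cl (rep c) = c) (qfG : quasi_finite G)
  (ordG : isotropy_orders_invertible G R).
Local Notation J := {classic iso_class G}.
Local Notation RGM := (RG_mod R G).
Local Notation RMod c := (right_mod (group_ring R (aut (rep c)))).
Local Notation ops := (RG_abelian R G).
Implicit Types (c d : J).

Lemma fg_projective_Res_rep c (P : RG_module R G) :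
  fg_projective (A := RGM) P -> fg_projective (A := RMod c) (Res (rep c) P).
Proof.
apply: fg_projective_Res => z; first exact: (qfG.2 (rep c) z).1.
  exact: (qfG.2 (rep c) z).2.
exact: ordG.
Qed.

Definition below c : {fset J} := fset_set ([set d | iso_le d c]%classic : set J).

Lemma in_below c d : (d \in below c) = `[< iso_le d c >].
Proof.
rewrite in_fset_set; last exact: qfG.1.
by apply/idP/asboolP; rewrite inE.
Qed.

Lemma supported_mor (x : G) : supported (RG_mor R x) (below (iso_cl x)).
Proof.
move=> y yx m; apply: val_inj; apply/funext => f; case/negP: yx.
by rewrite in_below; apply/asboolP/iso_leP; exists.
Qed.

Lemma supported_free (t : seq G) :
  supported (RG_free R t) (flatten [seq (below (iso_cl x) : seq J) | x <- t]).
Proof.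
elim: t => [|x t IHt] y /=; first by move=> _ m; exact: thinmx0.
rewrite mem_cat negb_or => /andP[yx yt] [m n].
by rewrite (supported_mor yx m) (IHt y yt n).
Qed.

Lemma supported_fg_projective (P : RG_module R G) : fg_projective (A := RGM) P ->
  exists2 s : seq J, uniq s & supported P s.
Proof.
move=> /(fg_projP ops)[t [f [g gf]]].
exists (undup (flatten [seq (below (iso_cl x) : seq J) | x <- t])).
  exact: undup_uniq.
move=> y; rewrite mem_undup => yt m.
have fm : f $ m = 0 by exact: supported_free yt _.
by rewrite -(gf y m) fm (app0 ops).
Qed.

Lemma supported_Ext c (Q : RMod c) : supported (Ext Q) (below c).
Proof.
move=> y yc t.
apply: (@tensor_ind _ _ _ _ _ _ (idfun : {linear mor_tensor Q y -> mor_tensor Q y}) \0).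
move=> q l /=; rewrite (supported_mor (x := rep c) _ l) ?repP //.
exact: (linear0 (tens (@mor_act R G (rep c) y) q)).
Qed.

(** [Ext Q] is a projective module mapping onto [Inc Q] with kernel [K] supported
    strictly below [c]; there [K] agrees with [Ext Q], whose restrictions are
    finitely generated projective, so the pieces of [K] are covered by induction. *)
Lemma has_class_Inc c (Q : RMod c) : fg_projective Q ->
  exists k, has_class (A := RGM) (Inc Q) k.
Proof.
have [n] := ubnP #|` below c|; elim: n => // n IHn in c Q *.
rewrite ltnS => cn Qp.
have Ep : fg_projective (A := RGM) (Ext Q) by exact: fg_projective_Ext.
have [|K [KEc Ks Kd]] := peel repP (c := c) (@supported_Ext c Q).
  move=> d; rewrite in_below => /asboolP dc cd; exact: iso_le_anti.
have IncK d : d \in below c -> d != c ->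
    exists k, has_class (A := RGM) (cut (rep d) K) k.
  rewrite in_below => /asboolP dc dNc.
  have [||k Hk] := IHn d (Res (rep d) (Ext Q)).
  - apply: leq_trans cn; apply: fproper_ltn_card; rewrite fproperE.
    apply/andP; split.
      apply/fsubsetP => e; rewrite !in_below => /asboolP ed; apply/asboolP.
      exact: iso_le_trans ed dc.
    apply/negP => /fsubsetP/(_ c); rewrite !in_below => cd.
    have /cd/asboolP {}cd : `[< iso_le c c >] by exact/asboolP/iso_le_refl.
    by move/eqP: dNc; apply; exact: iso_le_anti.
  - exact: fg_projective_Res_rep.
  exists k; apply: (has_class_iso ops _ Hk).
  by apply: (iso_trans ops (Inc_Res _ _)); apply: iso_sym; exact: Kd.
pose F d := if pselect (exists k, has_class (A := RGM) (cut (rep d) K) k) is left e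
  then sval (cid e) else ab_zero.
have /(_ F) [||m Km] := has_class_filtration repP _ Ks.
- exact/filter_uniq/fset_uniq.
- move=> d; rewrite mem_filter => /andP[dNc dc]; rewrite /F.
  by case: pselect => [e|[]]; [exact: svalP (cid e) | exact: IncK].
exists (ab_add (K0_cl (FGProj Ep)) (ab_opp (ab_lsum [seq d <- below c | d != c] F))).
apply: (has_class_iso ops (iso_sym (Inc_cut _))).
exists m.+1; exact: (resolvedS (P := FGProj Ep) KEc Km).
Qed.

Lemma Inc_hom c : exists F : K0 (RMod c) -> K0 RGM, is_hom F /\
  forall Q : fg_proj (RMod c), has_class (A := RGM) (Inc (fg_mod Q)) (F (K0_cl Q)).
Proof.
pose f (Q : fg_proj (RMod c)) := sval (cid (has_class_Inc (fg_modP Q))).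
have fP (Q : fg_proj (RMod c)) : has_class (A := RGM) (Inc (fg_mod Q)) (f Q).
  exact: svalP (cid (has_class_Inc (fg_modP Q))).
have [P Q PQ|P0 P1 P2 P012|F [FH FE]] := @K0_lift (RMod c) _ f.
- apply: (has_class_uniq ops _ (fP Q)).
  exact: (has_class_iso ops (Inc_iso PQ) (fP P)).
- apply: (has_class_uniq ops (fP P1)).
  exact: (has_classD ops (Inc_short_exact P012) (fP P0) (fP P2)).
by exists F; split=> // Q; rewrite FE.
Qed.

Definition Inc_K0 c : K0 (RMod c) -> K0 RGM := sval (cid (Inc_hom c)).

Lemma Inc_K0_hom c : is_hom (@Inc_K0 c).
Proof. by have [] := svalP (cid (Inc_hom c)). Qed.

Lemma Inc_K0P c (Q : fg_proj (RMod c)) :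
  has_class (A := RGM) (Inc (fg_mod Q)) (Inc_K0 (K0_cl Q)).
Proof. by have [_] := svalP (cid (Inc_hom c)); apply. Qed.

Definition Res_proj c (P : fg_proj RGM) : fg_proj (RMod c) :=
  FGProj (fg_projective_Res_rep c (fg_modP P)).

Lemma Res_finite (P : fg_proj RGM) :
  finite_set [set c : iso_class G | K0_cl (Res_proj c P) <> ab_zero]%classic.
Proof.
have [s us Ps] := supported_fg_projective (fg_modP P).
apply: (sub_finite_set _ (finite_seq s)) => c /= Pc; apply: contrapT => /negP cs.
apply: Pc; apply: (K0_cl_zero (right_mod_abelian _)) => i m.
by apply: Ps; rewrite repP.
Qed.

Definition Res_gen (P : fg_proj RGM) : splitK0 R rep := DSum (Res_finite P).

Lemma Res_K0_ex : exists F : K0 RGM -> splitK0 R rep, is_hom F /\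
  forall P, F (K0_cl P) = Res_gen P.
Proof.
apply: K0_lift => [P Q PQ|P0 P1 P2 P012]; apply: dsum_eq => c /=.
  exact/K0_cl_iso/Res_iso.
exact/K0_cl_exact/Res_short_exact.
Qed.

Definition Res_K0 : K0 RGM -> splitK0 R rep := sval (cid Res_K0_ex).

Lemma Res_K0_hom : is_hom Res_K0.
Proof. by have [] := svalP (cid Res_K0_ex). Qed.

Lemma Res_K0E P c : dsum_val (Res_K0 (K0_cl P)) c = K0_cl (Res_proj c P).
Proof. by have [_ /(_ P)] := svalP (cid Res_K0_ex); rewrite /Res_K0 => ->. Qed.

(** Restriction turns a projective resolution of [M] into one of [Res (rep c) M]. *)
Lemma Res_K0_has_class M k c : has_class (A := RGM) M k ->
  has_class (A := RMod c) (Res (rep c) M) (dsum_val (Res_K0 k) c).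
Proof.
move=> [n r]; exists n; elim: r => {n M k} [P M PM|n K P M k KPM _ IH].
  by rewrite Res_K0E; apply: (resolved0 (P := Res_proj c P)); exact: Res_iso.
rewrite Res_K0_hom (hom_opp Res_K0_hom) /= Res_K0E.
by apply: resolvedS IH; exact: (Res_short_exact (rep c) KPM).
Qed.

Definition dsum_support (q : splitK0 R rep) : {fset J} :=
  fset_set ([set c | dsum_val q c <> ab_zero]%classic : set J).

Lemma dsum_supportP (q : splitK0 R rep) c :
  dsum_val q c <> ab_zero -> c \in dsum_support q.
Proof. by move=> qc; rewrite in_fset_set ?inE //; exact: dsum_finite. Qed.

Definition Inc_sum (q : splitK0 R rep) : K0 RGM :=
  ab_lsum (dsum_support q) (fun c => Inc_K0 (dsum_val q c)).

Lemma Inc_sum_support (q : splitK0 R rep) (s : seq J) : uniq s ->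
  (forall c, dsum_val q c <> ab_zero -> c \in s) ->
  Inc_sum q = ab_lsum s (fun c => Inc_K0 (dsum_val q c)).
Proof.
move=> us qs; have I0 c : Inc_K0 (dsum_val q c) <> ab_zero -> dsum_val q c <> ab_zero.
  by move=> h q0; apply: h; rewrite q0 (hom_zero (@Inc_K0_hom c)).
apply: ab_lsum_support => //; first exact: fset_uniq.
  by move=> c _ /I0/qs.
by move=> c _ /I0; exact: dsum_supportP.
Qed.

Lemma Inc_sum_hom : is_hom Inc_sum.
Proof.
move=> p q.
pose s : seq J :=
  undup (dsum_support (ab_add p q) ++ dsum_support p ++ dsum_support q).
have us : uniq s by exact: undup_uniq.
rewrite !(@Inc_sum_support _ s) //; first last.
- by move=> c /dsum_supportP rc; rewrite mem_undup !mem_cat rc ?orbT.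
- by move=> c /dsum_supportP rc; rewrite mem_undup !mem_cat rc ?orbT.
- by move=> c /dsum_supportP rc; rewrite mem_undup !mem_cat rc ?orbT.
by rewrite -ab_lsumD; apply: eq_ab_lsum => c _; rewrite -Inc_K0_hom.
Qed.

(** The filtration of [P] by isomorphism classes computes the class of [P] as the sum
    of the classes of [Inc (Res (rep c) P)], and a class is unique. *)
Lemma Res_K0K : cancel Res_K0 Inc_sum.
Proof.
apply: (@eq_K0_hom _ _ (Inc_sum \o Res_K0) id) => // [a b|P] /=.
  by rewrite Res_K0_hom Inc_sum_hom.
have [s us Ps] := supported_fg_projective (fg_modP P).
rewrite (Inc_sum_support us); last first.
  move=> c; rewrite Res_K0E => Pc; apply: contrapT => /negP cs.
  apply: Pc; apply: (K0_cl_zero (right_mod_abelian _)) => i m.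
  by apply: Ps; rewrite repP.
apply: (has_class_uniq ops _ (has_class_fg_proj ops P)).
apply: (has_class_filtration repP us Ps) => c _.
rewrite Res_K0E; apply: (has_class_iso ops (Inc_Res _ _)).
exact: Inc_K0P (Res_proj c P).
Qed.

Lemma Res_Inc_K0 c (k : K0 (RMod c)) : dsum_val (Res_K0 (Inc_K0 k)) c = k.
Proof.
apply: (@eq_K0_hom _ _ (fun k => dsum_val (Res_K0 (Inc_K0 k)) c) id) => // [a b|Q].
  by rewrite Inc_K0_hom Res_K0_hom.
have H := right_mod_abelian (group_ring R (aut (rep c))).
apply: (has_class_uniq H (Res_K0_has_class c (Inc_K0P Q))).
exact: (has_class_iso H (Res_Inc _) (has_class_fg_proj H Q)).
Qed.

Lemma Res_Inc_K0_neq c d (k : K0 (RMod c)) : d != c ->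
  dsum_val (Res_K0 (Inc_K0 k)) d = ab_zero.
Proof.
move=> dc; apply: (@eq_K0_hom _ _ (fun k => dsum_val (Res_K0 (Inc_K0 k)) d)
  (fun=> ab_zero)) => // [a b|a b|Q].
- by rewrite Inc_K0_hom Res_K0_hom.
- by rewrite ab_add0.
have H := right_mod_abelian (group_ring R (aut (rep d))).
apply: (has_class_uniq H (Res_K0_has_class d (Inc_K0P Q))).
apply: (has_class_zero H); apply: Res_Inc_zero => /(iso_rep repP).
by rewrite repP => E; move/eqP: dc.
Qed.

Lemma Inc_sumK : cancel Inc_sum Res_K0.
Proof.
move=> q; apply: dsum_eq => d.
pose s : seq J := undup ((d : J) :: dsum_support q).
have us : uniq s by exact: undup_uniq.
have ds : (d : J) \in s by rewrite mem_undup mem_head.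
rewrite (Inc_sum_support us) => [|c qc]; last first.
  by rewrite mem_undup inE (dsum_supportP qc) orbT.
have coord_hom : is_hom (fun k => dsum_val (Res_K0 k) d).
  by move=> a b; rewrite Res_K0_hom.
rewrite (hom_lsum coord_hom) (ab_lsum_single us ds) ?Res_Inc_K0 // => c _ cd.
by apply: Res_Inc_K0_neq; rewrite eq_sym.
Qed.
End Main.

Theorem theorem6p16 (R : comPzRingType) (G : EI_category)
    (rep : iso_class G -> G) (repP : forall c : iso_class G, iso_cl (rep c) = c)
    (qfG : quasi_finite G) (ordG : isotropy_orders_invertible G R) :
  exists (ResK : K0 (RG_mod R G) -> splitK0 R rep)
         (IncK : splitK0 R rep -> K0 (RG_mod R G)),
    [/\ is_hom ResK,
        forall (P : fg_proj (RG_mod R G)) (c : iso_class G),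
          is_class (A := right_mod (group_ring R (aut (rep c))))
            (Res (rep c) (fg_mod P)) (dsum_val (ResK (K0_cl P)) c),
        is_hom IncK,
        forall (Q : forall c : iso_class G,
                  fg_proj (right_mod (group_ring R (aut (rep c)))))
               (q : splitK0 R rep),
          (forall c : iso_class G, dsum_val q c = K0_cl (Q c)) ->
          exists F : iso_class G -> K0 (RG_mod R G),
            (forall c : iso_class G,
               is_class (A := RG_mod R G) (@Inc R G (rep c) (fg_mod (Q c))) (F c))
            /\ is_sum F (IncK q)
      & cancel ResK IncK /\ cancel IncK ResK].
Proof.
exists (Res_K0 repP qfG ordG), (Inc_sum repP qfG ordG); split.
- exact: Res_K0_hom.
- move=> P c; rewrite Res_K0E; apply: (has_class_is_class (right_mod_abelian _)).
  exact: (has_class_fg_proj (right_mod_abelian _) (Res_proj rep qfG ordG c P)).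
- exact: Inc_sum_hom.
- move=> Q q qQ; exists (fun c => Inc_K0 repP qfG ordG (dsum_val q c)); split.
    move=> c; rewrite qQ; apply: (has_class_is_class (RG_abelian R G)).
    exact: Inc_K0P.
  exists (dsum_support q); split; [exact: fset_uniq | | by []].
  move=> c Fc; apply: dsum_supportP => qc; apply: Fc.
  by rewrite qc (hom_zero (@Inc_K0_hom _ _ _ _ _ _ c)).
- by split; [exact: Res_K0K | exact: Inc_sumK].
Qed.
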